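(* Let $n\ge1$, let $p\ge n+1$ and let $A_1,\ldots,A_n\in\mathrm{GL}_p(\mathbb{Z})$ be matrices, diagonalizable over $\mathbb{R}$, with the following properties: (i) the matrices $A_1,\ldots,A_n$ commute, so they are codiagonalizable; (ii) let $(e_1,\ldots,e_p)$ be a common basis of diagonalization for $A_1,\ldots,A_n$, and for $1\le k\le p$ denote by $\lambda_k(A_l)$ the eigenvalue of $A_l$ on $E_k=\mathrm{Span}(e_k)$; then the subgroup $\langle|\lambda_1(A_1)|,\ldots,|\lambda_1(A_n)|\rangle$ of $\mathbb{R}_+^*$ has rank $n$. The group $H:=\langle A_1,\ldots,A_n\rangle$ is canonically isomorphic to $\mathbb{Z}^n$, defining a group isomorphism $\phi:\mathbb{Z}^n\to H$ (sending the $l$-th canonical generator to $A_l$). Then there exists an LCP structure on $Q((S^1)^n,\phi)$ of rank $n$. In particular, the rank of an LCP manifold can be any positive integer.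
   Context: The manifold $Q(\overline{\mathcal N},\phi)$. Let $\overline{\mathcal N}$ be a compact manifold with universal cover $\mathcal N$ and fundamental group $\Gamma$, and let $\phi:\Gamma\to\mathrm{Aff}_p(\mathbb{Z}):=\mathbb{R}^p\rtimes\mathrm{GL}_p(\mathbb{Z})$ be a group morphism into the affine transformations of $\mathbb{R}^p$ with linear part in $\mathrm{GL}_p(\mathbb{Z})$. On $\widetilde M:=\mathbb{R}^p\times\mathcal N$ let $\mathcal D\simeq\mathbb{Z}^p$ be the group of translations $(a,x)\mapsto(a+z,x)$, $z\in\mathbb{Z}^p$, and consider the group $\{(\phi(\gamma),\gamma):\gamma\in\Gamma\}\subset\mathrm{Diff}(\widetilde M)$, acting factorwise. The group $G$ generated by both acts freely, properly discontinuously and cocompactly on $\widetilde M$, and $Q(\overline{\mathcal N},\phi):=\widetilde M/G$, a compact manifold with fundamental group $G$. Here $\overline{\mathcal N}=(S^1)^n$, $\mathcal N=\mathbb{R}^n$, $\Gamma=\mathbb{Z}^n$, and $\phi$ takes values in $H\subset\mathrm{GL}_p(\mathbb{Z})\subset\mathrm{Aff}_p(\mathbb{Z})$. Weyl structures. A Weyl structure on a conformal manifold $(M,c)$ is a torsion-free connection $D$ on $TM$ such that for every $g\in c$ there is a $1$-form $\theta_g$ (the Lee form) with $Dg=-2\theta_g\otimes g$. It is closed (resp. exact) if $\theta_g$ is closed (resp. exact) for one, equivalently all, $g\in c$. If $D$ is closed, its lift to the universal cover $\widetilde M$ is the Levi-Civita connection of a metric $h_D$ in the lifted conformal class, unique up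 to a positive constant factor, and $\pi_1(M)$ acts on $(\widetilde M,h_D)$ by similarities. A similarity of ratio $\lambda>0$ between Riemannian manifolds $(M_1,g_1)$, $(M_2,g_2)$ is a diffeomorphism $s:M_1\to M_2$ with $s^*g_2=\lambda^2g_1$. LCP manifolds. An LCP (locally conformally product) structure on a compact manifold $M$ is a conformal class $c$ together with a closed, non-exact Weyl structure $D$ with reducible, non-flat holonomy; $(M,c,D)$ is then an LCP manifold. By a theorem of Kourganoff, one then has $(\widetilde M,h_D)=\mathbb{R}^q\times(N,g_N)$ (Riemannian product), where $q\ge1$, $\mathbb{R}^q$ is Euclidean space and $(N,g_N)$ is a non-flat, non-complete Riemannian manifold with irreducible holonomy. The rank of an LCP manifold is the rank of the subgroup of $\mathbb{R}_+^*$ generated by the similarity ratios of the elements of $\pi_1(M)$ acting on $(\widetilde M,h_D)$. *)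

(* Defs.v *)
From HB Require Import structures.
From mathcomp Require Import all_boot all_order all_algebra.
From mathcomp Require Import all_classical all_reals all_analysis.
Set Implicit Arguments.
Unset Strict Implicit.
Unset Printing Implicit Defensive.
Import Order.TTheory GRing.Theory Num.Theory.
Import numFieldNormedType.Exports.
Local Open Scope classical_set_scope.
Local Open Scope ring_scope.

(* A compact manifold M with universal cover R^m is presented as the quotient  *)
(* of R^m by a deck group G acting freely, properly discontinuously and        *)
(* cocompactly, so that pi_1(M) = G. The quotient map being a local            *)
(* diffeomorphism, the functions, forms, metrics and connections on M are      *)
(* exactly the G-invariant ones on R^m, written here in the global coordinates *)
(* of R^m: a metric is its Gram matrix, a 1-form its row of coefficients.      *)

(** * Subgroups and ranks *)

Definition mul_subgroup {R : realType} (K : set R) : Prop :=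
  [/\ (forall x, K x -> 0 < x), K 1, (forall x y, K x -> K y -> K (x * y))
    & (forall x, K x -> K x^-1)].

Definition GL_subgroup {S : comUnitRingType} {p : nat} (K : set 'M[S]_p) : Prop :=
  [/\ (forall X, K X -> X \in unitmx), K 1%:M,
      (forall X Y, K X -> K Y -> K (X *m Y))
    & (forall X, K X -> K (invmx X))].

Definition transf_subgroup {T : Type} (K : set (T -> T)) : Prop :=
  [/\ K idfun, (forall f g, K f -> K g -> K (f \o g))
    & (forall f, K f -> exists g, [/\ K g, cancel f g & cancel g f])].

Definition mul_indep {R : realType} {r : nat} (u : 'I_r -> R) : Prop :=
  forall k : 'I_r -> int, \prod_i (u i) ^ (k i) = 1 -> forall i, k i = 0.

(* The rank of an abelian group is the largest size of a Z-independent family. *)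
Definition mul_rank {R : realType} (K : set R) (r : nat) : Prop :=
  (exists u : 'I_r -> R, (forall i, K (u i)) /\ mul_indep u) /\
  (forall u : 'I_r.+1 -> R, (forall i, K (u i)) -> ~ mul_indep u).

(** * Calculus on R^m *)

Definition pd {R : realType} {m : nat} (i : 'I_m) (f : 'cV[R]_m -> R) :
    'cV[R]_m -> R :=
  fun x => 'D_(delta_mx i ord0) f x.

Fixpoint Ck {R : realType} {m : nat} (k : nat) (f : 'cV[R]_m -> R) : Prop :=
  continuous f /\
  if k is k'.+1 then
    forall i, (forall x, derivable f x (delta_mx i ord0)) /\ Ck k' (pd i f)
  else True.

Definition smooth {R : realType} {m : nat} (f : 'cV[R]_m -> R) : Prop :=
  forall k, Ck k f.

Definition smooth_mx {R : realType} {m a b : nat}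
    (F : 'cV[R]_m -> 'M[R]_(a, b)) : Prop :=
  forall i j, smooth (fun x => F x i j).

Definition pd_mx {R : realType} {m a b : nat} (i : 'I_m)
    (F : 'cV[R]_m -> 'M[R]_(a, b)) (x : 'cV[R]_m) : 'M[R]_(a, b) :=
  \matrix_(k, l) pd i (fun y => F y k l) x.

Definition grad {R : realType} {m : nat} (f : 'cV[R]_m -> R) (x : 'cV[R]_m) :
    'rV[R]_m :=
  \row_i pd i f x.

Definition jac {R : realType} {m : nat} (s : 'cV[R]_m -> 'cV[R]_m)
    (x : 'cV[R]_m) : 'M[R]_m :=
  \matrix_(k, i) pd i (fun y => s y k ord0) x.

Definition smooth_curve {R : realType} {m : nat} (c : R -> 'cV[R]_m) : Prop :=
  forall k (N : nat) t, derivable (derive1n N (fun s => c s k ord0)) t 1.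

Definition deck_group {R : realType} {m : nat}
    (G : set ('cV[R]_m -> 'cV[R]_m)) : Prop :=
  [/\ transf_subgroup G,
      (forall s, G s -> smooth_mx s),
      (forall s x, G s -> s x = x -> s = idfun),
      (forall K : set 'cV[R]_m, compact K ->
         finite_set [set s | G s /\ (s @` K) `&` K !=set0])
    & (exists2 K : set 'cV[R]_m, compact K &
         forall x, exists s y, [/\ G s, K y & s y = x])].

(** * Metrics and conformal classes *)

Definition metric {R : realType} {m : nat} (g : 'cV[R]_m -> 'M[R]_m) : Prop :=
  [/\ smooth_mx g, (forall x, (g x)^T = g x)
    & (forall x (v : 'cV[R]_m), v != 0 ->
         0 < (v^T *m g x *m v) ord0 ord0)].

Definition pullback {R : realType} {m : nat} (s : 'cV[R]_m -> 'cV[R]_m)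
    (g : 'cV[R]_m -> 'M[R]_m) (x : 'cV[R]_m) : 'M[R]_m :=
  (jac s x)^T *m g (s x) *m jac s x.

Definition metric_on {R : realType} {m : nat} (G : set ('cV[R]_m -> 'cV[R]_m))
    (g : 'cV[R]_m -> 'M[R]_m) : Prop :=
  metric g /\ forall s x, G s -> pullback s g x = g x.

Definition function_on {R : realType} {m : nat} (G : set ('cV[R]_m -> 'cV[R]_m))
    (f : 'cV[R]_m -> R) : Prop :=
  smooth f /\ forall s x, G s -> f (s x) = f x.

Definition form_on {R : realType} {m : nat} (G : set ('cV[R]_m -> 'cV[R]_m))
    (theta : 'cV[R]_m -> 'rV[R]_m) : Prop :=
  smooth_mx theta /\ forall s x, G s -> theta (s x) *m jac s x = theta x.

Definition conformal {R : realType} {m : nat} (g h : 'cV[R]_m -> 'M[R]_m) :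
    Prop :=
  exists2 f : 'cV[R]_m -> R, smooth f & forall x, h x = expR (2 * f x) *: g x.

Definition conformal_class {R : realType} {m : nat}
    (G : set ('cV[R]_m -> 'cV[R]_m)) (c : set ('cV[R]_m -> 'M[R]_m)) : Prop :=
  exists2 g, metric_on G g & c = [set h | metric_on G h /\ conformal g h].

(** * Connections *)

(* D x i is the matrix with (k, j) entry the Christoffel symbol Gamma^k_ij at  *)
(* x: D_{d_i} d_j = sum_k Gamma^k_ij d_k. Each identity below between matrices *)
(* is the usual one between Christoffel symbols, with one index fixed.         *)
Definition christoffel (R : realType) (m : nat) : Type :=
  'cV[R]_m -> 'I_m -> 'M[R]_m.

(* s is affine for D:                                                          *)
(* Gamma^l_ij d_l s^k = d_i d_j s^k + (Gamma^k_ab o s) d_i s^a d_j s^b.        *)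
Definition preserves {R : realType} {m : nat} (s : 'cV[R]_m -> 'cV[R]_m)
    (D : christoffel R m) : Prop :=
  forall x i, jac s x *m D x i =
    pd_mx i (jac s) x + \sum_a jac s x a i *: (D (s x) a *m jac s x).

Definition torsion_free {R : realType} {m : nat} (D : christoffel R m) : Prop :=
  forall x i j k, D x i k j = D x j k i.

Definition connection_on {R : realType} {m : nat}
    (G : set ('cV[R]_m -> 'cV[R]_m)) (D : christoffel R m) : Prop :=
  (forall i, smooth_mx (D^~ i)) /\ forall s, G s -> preserves s D.

(* Gram matrix of the bilinear form D_{d_i} g. *)
Definition cov {R : realType} {m : nat} (D : christoffel R m)
    (g : 'cV[R]_m -> 'M[R]_m) (x : 'cV[R]_m) (i : 'I_m) : 'M[R]_m :=
  pd_mx i g x - (D x i)^T *m g x - g x *m D x i.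

(* Matrix of the endomorphism R(d_i, d_j). *)
Definition curvature {R : realType} {m : nat} (D : christoffel R m)
    (x : 'cV[R]_m) (i j : 'I_m) : 'M[R]_m :=
  pd_mx i (D^~ j) x - pd_mx j (D^~ i) x + D x i *m D x j - D x j *m D x i.

Definition flat {R : realType} {m : nat} (D : christoffel R m) : Prop :=
  forall x i j, curvature D x i j = 0.

(* D_{c'} V = 0 *)
Definition parallel_along {R : realType} {m : nat} (D : christoffel R m)
    (c V : R -> 'cV[R]_m) : Prop :=
  forall (t : R) k, is_derive t (1 : R) (fun s => V s k ord0)
    (- (\sum_i derive1 (fun s => c s i ord0) t *: (D (c t) i *m V t)) k ord0).

(* transport D x y P: there is a piecewise smooth curve from x to y with       *)
(* parallel transport P. A smooth curve on [0, 1] is taken to be the           *)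
(* restriction of a smooth curve on R.                                         *)
Inductive transport {R : realType} {m : nat} (D : christoffel R m)
    (x : 'cV[R]_m) : 'cV[R]_m -> 'M[R]_m -> Prop :=
| transport_nil : transport D x x 1%:M
| transport_cons y z (P Q : 'M[R]_m) (c : R -> 'cV[R]_m) :
    transport D x y P -> smooth_curve c -> c 0 = y -> c 1 = z ->
    (forall v, exists V : R -> 'cV[R]_m,
       [/\ parallel_along D c V, V 0 = v & V 1 = Q *m v]) ->
    transport D x z (Q *m P).

(* The holonomy group, at the image of x, of the connection induced by D on    *)
(* the quotient M: a loop of M at that point lifts to a curve from x to s x    *)
(* with s in G, and d_x s identifies the two tangent spaces.                   *)
Definition holonomy {R : realType} {m : nat} (G : set ('cV[R]_m -> 'cV[R]_m))
    (D : christoffel R m) (x : 'cV[R]_m) : set 'M[R]_m :=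
  [set P | exists2 s, G s & transport D x (s x) (jac s x *m P)].

Definition reducible {R : realType} {m : nat} (H : set 'M[R]_m) : Prop :=
  exists W : {vspace 'cV[R]_m}, [/\ W != 0%VS, W != fullv
    & forall P v, H P -> v \in W -> P *m v \in W].

(** * Weyl structures and LCP structures *)

Definition lee_form {R : realType} {m : nat} (D : christoffel R m)
    (g : 'cV[R]_m -> 'M[R]_m) (theta : 'cV[R]_m -> 'rV[R]_m) : Prop :=
  forall x i, cov D g x i = (- 2 * theta x ord0 i) *: g x.

Definition weyl {R : realType} {m : nat} (G : set ('cV[R]_m -> 'cV[R]_m))
    (c : set ('cV[R]_m -> 'M[R]_m)) (D : christoffel R m) : Prop :=
  [/\ connection_on G D, torsion_free D
    & forall g, c g -> exists2 theta, form_on G theta & lee_form D g theta].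

Definition closed_form {R : realType} {m : nat}
    (theta : 'cV[R]_m -> 'rV[R]_m) : Prop :=
  forall x i j, pd i (fun y => theta y ord0 j) x = pd j (fun y => theta y ord0 i) x.

Definition exact_form {R : realType} {m : nat} (G : set ('cV[R]_m -> 'cV[R]_m))
    (theta : 'cV[R]_m -> 'rV[R]_m) : Prop :=
  exists2 f, function_on G f & forall x, theta x = grad f x.

Definition closed_weyl {R : realType} {m : nat} (c : set ('cV[R]_m -> 'M[R]_m))
    (D : christoffel R m) : Prop :=
  exists g theta, [/\ c g, lee_form D g theta & closed_form theta].

Definition exact_weyl {R : realType} {m : nat} (G : set ('cV[R]_m -> 'cV[R]_m))
    (c : set ('cV[R]_m -> 'M[R]_m)) (D : christoffel R m) : Prop :=
  exists g theta, [/\ c g, lee_form D g theta & exact_form G theta].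

Record LCP {R : realType} {m : nat} (G : set ('cV[R]_m -> 'cV[R]_m))
    (c : set ('cV[R]_m -> 'M[R]_m)) (D : christoffel R m) : Prop := {
  LCP_deck_group : deck_group G;
  LCP_conformal_class : conformal_class G c;
  LCP_weyl : weyl G c D;
  LCP_closed : closed_weyl c D;
  LCP_non_exact : ~ exact_weyl G c D;
  LCP_reducible : forall x, reducible (holonomy G D x);
  LCP_non_flat : ~ flat D
}.

(* h is a metric h_D: on the universal cover, h lies in the lifted conformal   *)
(* class and its Levi-Civita connection is the (torsion-free) connection D.    *)
Definition weyl_metric {R : realType} {m : nat} (c : set ('cV[R]_m -> 'M[R]_m))
    (D : christoffel R m) (h : 'cV[R]_m -> 'M[R]_m) : Prop :=
  [/\ metric h, (forall g, c g -> conformal g h)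
    & (forall x i, cov D h x i = 0)].

Definition similarity_ratios {R : realType} {m : nat}
    (G : set ('cV[R]_m -> 'cV[R]_m)) (h : 'cV[R]_m -> 'M[R]_m) : set R :=
  [set lambda | 0 < lambda /\ exists2 s, G s &
     forall x, pullback s h x = lambda ^+ 2 *: h x].

Definition LCP_rank {R : realType} {m : nat} (G : set ('cV[R]_m -> 'cV[R]_m))
    (c : set ('cV[R]_m -> 'M[R]_m)) (D : christoffel R m) (r : nat) : Prop :=
  exists2 h, weyl_metric c D h &
    mul_rank (smallest mul_subgroup (similarity_ratios G h)) r.

(** * The manifold Q((S^1)^n, phi) *)

Definition lattice_translation {R : realType} {n p : nat} (z : 'cV[int]_p) :
    'cV[R]_(p + n) -> 'cV[R]_(p + n) :=
  fun u => u + col_mx (map_mx intr z) 0.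

Definition twisted_translation {R : realType} {n p : nat}
    (phi : 'cV[int]_n -> 'M[int]_p) (gamma : 'cV[int]_n) :
    'cV[R]_(p + n) -> 'cV[R]_(p + n) :=
  fun u => col_mx (map_mx intr (phi gamma) *m usubmx u)
                  (dsubmx u + map_mx intr gamma).

(* Q is R^(p + n) = R^p x R^n modulo this group. *)
Definition Q_group {R : realType} {n p : nat} (phi : 'cV[int]_n -> 'M[int]_p) :
    set ('cV[R]_(p + n) -> 'cV[R]_(p + n)) :=
  smallest transf_subgroup
    (range (@lattice_translation R n p) `|` range (twisted_translation phi)).

Definition is_isomorphism {n p : nat} (phi : 'cV[int]_n -> 'M[int]_p)
    (H : set 'M[int]_p) : Prop :=
  [/\ (forall z w, phi (z + w) = phi z *m phi w), injective phi
    & range phi = H].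

(* Main.v *)
Require Import Defs.
From mathcomp Require Import all_boot all_order all_algebra.
From mathcomp Require Import all_classical all_reals all_analysis.
From mathcomp Require Import ring lra zify.
Set Implicit Arguments.
Unset Strict Implicit.
Unset Printing Implicit Defensive.
Import Order.TTheory GRing.Theory Num.Theory.
Import numFieldNormedType.Exports.
Local Open Scope classical_set_scope.
Local Open Scope ring_scope.

(* Idea. Let mu_k in R^n have coordinates ln |lambda_k(A_l)|, put a = mu_1 and
   let y_1, ..., y_p be the coordinates of R^p in the common eigenbasis. On
   R^p x R^n the metric
     h = sum_k exp(2 <a - mu_k, t>) dy_k^2 + exp(2 <a, t>) dt^2
   is multiplied by |lambda_1(A^gamma)|^2 under (x, t) |-> (A^gamma x + z, t + gamma),
   so that g = exp(-2 <a, t>) h descends to Q and the Levi-Civita connection D of h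
   is a Weyl structure with Lee form <a, dt> for g. This form is closed; it is not
   exact, since a function with differential <a, dt> is not periodic in t. Because
   dy_1 is parallel, the holonomy is reducible. The component of the curvature in
   the directions d/dy_k and a shows that flatness forces <a, mu_k> to be 0 or |a|^2
   for every k, whereas sum_k mu_k = 0 and <a, mu_1> = |a|^2 > 0.

   For the last claim take f = prod_(0 <= i <= n) (X - 4 i) - 1, which is irreducible
   (Schur) with real roots theta_k close to 4 k, and A_l = M - 4 l for 1 <= l <= n,
   where M is the companion matrix of f. By irreducibility a multiplicative relation
   between the |theta_0 - 4 l| holds for all the roots, and the matrix
   (ln |theta_k - 4 l|) is strictly diagonally dominant. *)

(** * Calculus on R^m *)

Section DeriveLine.
Context {R : realType}.

(** Restriction to the line through [x] in direction [v] gives a function of one variable, to which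
    the chain rule and the mean value theorem apply. *)
Lemma is_derive_lineP (V W : normedModType R) (f : V -> W) (x v : V) (d : W) :
  is_derive x v f d <-> is_derive (0 : R) 1 (fun h : R => f (h *: v + x)) d.
Proof.
have E : 'D_1 (fun h : R => f (h *: v + x)) 0 = 'D_v f x.
  rewrite /derive; set g1 := fun h => h^-1 *: _; set g2 := fun h => h^-1 *: _.
  suff -> : g1 = g2 by [].
  by rewrite funeqE /g1 /g2 => h /=; rewrite addr0 scale0r add0r [_%:A]mulr1.
have [D1 D2] := derivable1P f x v.
split=> [[df <-]|[df <-]]; first by rewrite -E; apply/derivableP/D1.
by rewrite E; apply/derivableP/D2.
Qed.

Lemma is_derive_shift_line (V W : normedModType R) (f : V -> W) (x v : V) (h : R) (d : W) :
  is_derive (h *: v + x) v f d ->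
  is_derive h 1 (fun s : R => f (s *: v + x)) d.
Proof.
move=> /is_derive_lineP df; apply/is_derive_lineP.
congr (is_derive _ _ _ _): df; apply/funext => s /=.
by rewrite [_%:A]mulr1 scalerDl addrA.
Qed.

End DeriveLine.

Section Calculus.
Context {R : realType} {m : nat}.
Implicit Types (f g : 'cV[R]_m -> R) (x v : 'cV[R]_m) (c : 'rV[R]_m).

Lemma continuous_addf f g :
  continuous f -> continuous g -> continuous (fun x => f x + g x).
Proof. by move=> cf cg x; exact: (continuousD (cf x) (cg x)). Qed.

Lemma continuous_scalef (r : R) f :
  continuous f -> continuous (fun x => r * f x).
Proof.
move=> cf x.
have cr : continuous (fun _ : 'cV[R]_m => r) by exact: cst_continuous.
exact: (continuousM (cr x) (cf x)).
Qed.

Definition linform c x : R := (c *m x) ord0 ord0.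

Lemma linformE c x : linform c x = \sum_i c ord0 i * x i ord0.
Proof. by rewrite /linform mxE. Qed.

Lemma linformD c x y : linform c (x + y) = linform c x + linform c y.
Proof. by rewrite /linform mulmxDr mxE. Qed.

Lemma linformZ c k x : linform c (k *: x) = k * linform c x.
Proof. by rewrite /linform -scalemxAr mxE. Qed.

Lemma linformDl c c' x : linform (c + c') x = linform c x + linform c' x.
Proof. by rewrite /linform mulmxDl mxE. Qed.

Lemma linformNl c x : linform (- c) x = - linform c x.
Proof. by rewrite /linform mulNmx mxE. Qed.

Lemma linformZl k c x : linform (k *: c) x = k * linform c x.
Proof. by rewrite /linform -scalemxAl mxE. Qed.

Lemma linform_delta c i : linform c (delta_mx i ord0) = c ord0 i.
Proof.
rewrite linformE (bigD1 i) //= mxE !eqxx mulr1 big1 ?addr0 // => j /negbTE ne.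
by rewrite mxE ne mulr0.
Qed.

Lemma is_derive_linform c x v : is_derive x v (linform c) (linform c v).
Proof.
apply/is_derive_lineP.
under [X in is_derive _ _ X _]eq_fun do rewrite linformD linformZ.
apply: is_derive_eq.
by rewrite /= scaler0 add0r addr0 [LHS]mulr1.
Qed.

Lemma is_derive_exp_linform c x v :
  is_derive x v (fun u => expR (linform c u)) (linform c v * expR (linform c x)).
Proof.
apply/is_derive_lineP.
have := is_derive_linform c x v => /is_derive_lineP d.
have -> : linform c x = linform c ((0 : R) *: v + x) by rewrite scale0r add0r.
rewrite mulrC.
exact: (@is_derive1_comp _ expR (fun h : R => linform c (h *: v + x))).
Qed.

Lemma continuous_linform c : continuous (linform c).
Proof.
rewrite (_ : linform c = fun x => \sum_i c ord0 i * x i ord0); last first.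
  by apply/funext => x; rewrite linformE.
elim: (index_enum _) => [|i s IH].
  by rewrite (_ : (fun _ => _) = cst 0);
    [exact: cst_continuous|apply/funext => y; rewrite big_nil].
rewrite (_ : (fun _ => _) =
    fun x => c ord0 i * x i ord0 + \sum_(j <- s) c ord0 j * x j ord0); last first.
  by apply/funext => y; rewrite big_cons.
apply: continuous_addf => //; apply: continuous_scalef.
exact: coord_continuous.
Qed.

Lemma pd_eq f x i d : is_derive x (delta_mx i ord0) f d -> pd i f x = d.
Proof. by case. Qed.

Lemma is_derive_pd f x i : derivable f x (delta_mx i ord0) ->
  is_derive x (delta_mx i ord0) f (pd i f x).
Proof. exact: derivableP. Qed.

Lemma Ck_continuous k f : Ck k f -> continuous f.
Proof. by case: k => [|k] []. Qed.

Lemma CkS k f : Ck k.+1 f <-> continuous f /\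
  forall i, (forall x, derivable f x (delta_mx i ord0)) /\ Ck k (pd i f).
Proof. by []. Qed.

Lemma Ck_cst k (r : R) : Ck k (fun _ : 'cV[R]_m => r).
Proof.
elim: k r => [|k IH] r; (split; first exact: cst_continuous) => // i.
split=> [x|]; first exact: derivable_cst.
rewrite (_ : pd i _ = fun=> 0); first exact: IH.
by apply/funext => x; apply: pd_eq; exact: is_derive_cst.
Qed.

Lemma CkD k f g : Ck k f -> Ck k g -> Ck k (fun x => f x + g x).
Proof.
elim: k f g => [|k IH] f g [cf df] [cg dg]; (split; first exact: continuous_addf) => // i.
have [{}df kf] := df i; have [{}dg kg] := dg i.
split=> [x|]; first exact: derivableD (df x) (dg x).
rewrite (_ : pd i _ = fun x => pd i f x + pd i g x); first exact: IH.
by apply/funext => x; apply: pd_eq; apply: is_deriveD; exact: is_derive_pd.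
Qed.

Lemma CkZ k (r : R) f : Ck k f -> Ck k (fun x => r * f x).
Proof.
elim: k f => [|k IH] f [cf df]; (split; first exact: continuous_scalef) => // i.
have [{}df kf] := df i.
split=> [x|]; first exact: (@derivableZ _ _ _ f r x _ (df x)).
rewrite (_ : pd i _ = fun x => r * pd i f x); first exact: IH.
apply/funext => x; apply: pd_eq.
exact: (@is_deriveZ _ _ _ f r x _ _ (is_derive_pd (df x))).
Qed.

Lemma smooth_cst (r : R) : smooth (fun _ : 'cV[R]_m => r).
Proof. by move=> k; exact: Ck_cst. Qed.

Lemma smoothD f g : smooth f -> smooth g -> smooth (fun x => f x + g x).
Proof. by move=> sf sg k; exact: CkD. Qed.

Lemma smoothZ (r : R) f : smooth f -> smooth (fun x => r * f x).
Proof. by move=> sf k; exact: CkZ. Qed.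

Lemma smoothN f : smooth f -> smooth (fun x => - f x).
Proof.
move=> sf; rewrite (_ : (fun _ => _) = fun x => -1 * f x); first exact: smoothZ.
by apply/funext => x; rewrite mulN1r.
Qed.

Lemma smooth_sum (I : Type) (r : seq I) (P : pred I) (F : I -> 'cV[R]_m -> R) :
  (forall i, P i -> smooth (F i)) -> smooth (fun x => \sum_(i <- r | P i) F i x).
Proof.
move=> sF; elim: r => [|i r IH].
  rewrite (_ : (fun _ => _) = fun=> 0); first exact: smooth_cst.
  by apply/funext => x; rewrite big_nil.
case Pi: (P i); last first.
  rewrite (_ : (fun _ => _) = fun x => \sum_(j <- r | P j) F j x) //.
  by apply/funext => x; rewrite big_cons Pi.
rewrite (_ : (fun _ => _) = fun x => F i x + \sum_(j <- r | P j) F j x).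
  by apply: smoothD => //; exact: sF.
by apply/funext => x; rewrite big_cons Pi.
Qed.

Lemma smooth_pd i f : smooth f -> smooth (pd i f).
Proof. by move=> sf k; have /CkS[_ /(_ i)[]] := sf k.+1. Qed.

Lemma smooth_derivable f : smooth f ->
  forall i x, derivable f x (delta_mx i ord0).
Proof. by move=> sf i x; have /CkS[_ /(_ i)[]] := sf 1%N. Qed.

Lemma smooth_continuous f : smooth f -> continuous f.
Proof. by move=> sf; exact: Ck_continuous (sf 0%N). Qed.

Lemma pd_linform i c x : pd i (linform c) x = c ord0 i.
Proof. by rewrite -linform_delta; apply: pd_eq; exact: is_derive_linform. Qed.

Lemma smooth_linform c : smooth (linform c).
Proof.
case=> [|k]; (split; first exact: continuous_linform) => // i.
split=> [x|]; first by have [] := is_derive_linform c x (delta_mx i ord0).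
rewrite (_ : pd i _ = fun=> c ord0 i); first exact: Ck_cst.
by apply/funext => x; exact: pd_linform.
Qed.

Lemma pd_exp_linform i c x :
  pd i (fun u => expR (linform c u)) x = c ord0 i * expR (linform c x).
Proof.
by rewrite -linform_delta; apply: pd_eq; exact: is_derive_exp_linform.
Qed.

Lemma smooth_exp_linform c : smooth (fun u => expR (linform c u)).
Proof.
have ce : continuous (fun u => expR (linform c u)).
  move=> x; apply: continuous_comp; first exact: continuous_linform.
  exact: continuous_expR.
elim=> [|k IH]; split=> // i.
split=> [x|]; first by have [] := is_derive_exp_linform c x (delta_mx i ord0).
rewrite (_ : pd i _ = fun x => c ord0 i * expR (linform c x)); first exact: CkZ.
by apply/funext => x; exact: pd_exp_linform.
Qed.

Lemma pdD f g i x : derivable f x (delta_mx i ord0) ->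
  derivable g x (delta_mx i ord0) ->
  pd i (fun u => f u + g u) x = pd i f x + pd i g x.
Proof. by move=> df dg; apply: pd_eq; apply: is_deriveD; exact: is_derive_pd. Qed.

Lemma pdZ r f i x : derivable f x (delta_mx i ord0) ->
  pd i (fun u => r * f u) x = r * pd i f x.
Proof.
by move=> df; apply: pd_eq; exact: (@is_deriveZ _ _ _ f r x _ _ (is_derive_pd df)).
Qed.

Lemma pd_cst i (r : R) x : pd i (fun _ : 'cV[R]_m => r) x = 0.
Proof. by apply: pd_eq; exact: is_derive_cst. Qed.

Lemma pd_sum (I : Type) (r : seq I) (P : pred I) (F : I -> 'cV[R]_m -> R) i x :
  (forall j, P j -> smooth (F j)) ->
  pd i (fun x => \sum_(j <- r | P j) F j x) x = \sum_(j <- r | P j) pd i (F j) x.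
Proof.
move=> sF; elim: r => [|j r IH].
  rewrite (_ : (fun _ => _) = fun=> 0); first by rewrite pd_cst big_nil.
  by apply/funext => y; rewrite big_nil.
rewrite big_cons; case Pj: (P j); last first.
  rewrite -IH; congr (pd i _ x).
  by apply/funext => y; rewrite big_cons Pj.
rewrite -IH -pdD; first last.
- exact/smooth_derivable/smooth_sum.
- exact/smooth_derivable/sF.
by congr (pd i _ x); apply/funext => y; rewrite big_cons Pj.
Qed.

End Calculus.

(** * Directional derivatives of smooth functions *)

Section Directional.
Context {R : realType} {m : nat}.
Implicit Types (f : 'cV[R]_m -> R) (x v : 'cV[R]_m).

Lemma is_derive_scale_dir f x v k d :
  is_derive x v f d -> is_derive x (k *: v) f (k * d).
Proof.
move=> /is_derive_lineP df; apply/is_derive_lineP.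
rewrite (_ : (fun _ => _) = (fun h : R => f (h *: v + x)) \o (fun s => s * k)).
  rewrite mulrC; apply: is_derive1_comp; first by rewrite mul0r.
  apply: is_derive_eq.
  by rewrite scaler0 add0r [LHS]mulr1.
by apply/funext => s /=; rewrite scalerA.
Qed.

Lemma is_derive_continuous_line (V : normedModType R) (f : V -> R) (x v : V) :
  (forall y, derivable f y v) -> continuous (fun h : R => f (h *: v + x)).
Proof.
move=> df h; apply/differentiable_continuous/derivable1_diffP.
by have [] := @is_derive_shift_line R _ _ f x v h _ (derivableP (df (h *: v + x))).
Qed.

(** Integrates a constant derivative over a unit step by the mean value theorem. It serves for the
    parallel coordinate form along a curve and for the primitive in the non-exactness argument. *)
Lemma is_derive_line_constant (V : normedModType R) (f : V -> R) (v : V) d :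
  (forall y, is_derive y v f d) -> forall x : V, f (v + x) - f x = d.
Proof.
move=> df x.
have dl (t : R) : t \in `]0, 1[%R ->
    is_derive t 1 (fun h : R => f (h *: v + x)) (cst d t).
  by move=> _; exact: is_derive_shift_line.
have cl : {within `[0, 1], continuous (fun h : R => f (h *: v + x))}.
  by apply: continuous_subspaceT; apply: is_derive_continuous_line => y;
    have [] := df y.
have [c _] := MVT ltr01 dl cl.
by rewrite scale1r scale0r add0r subr0 mulr1.
Qed.

Lemma MVT_dir f x v (df : 'cV[R]_m -> R) :
  (forall y, is_derive y v f (df y)) ->
  exists2 t, t \in `]0, 1[%R & f (v + x) - f x = df (t *: v + x).
Proof.
move=> dfP.
have dl (t : R) : t \in `]0, 1[%R ->
    is_derive t 1 (fun h : R => f (h *: v + x)) (df (t *: v + x)).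
  by move=> _; exact: is_derive_shift_line.
have cl : {within `[0, 1], continuous (fun h : R => f (h *: v + x))}.
  apply: continuous_subspaceT; apply: is_derive_continuous_line => y.
  by have [] := dfP y.
have [c c01] := MVT ltr01 dl cl.
by rewrite scale1r scale0r add0r subr0 mulr1; exists c.
Qed.

Lemma is_derive_cvgP f x v d :
  is_derive x v f d <->
  (fun h : R => h^-1 *: (f (h *: v + x) - f x)) @ 0^' --> d.
Proof.
split=> [[df <-]|cd]; first exact: df.
apply: DeriveDef; first by apply/cvg_ex; exists d.
exact: cvg_lim.
Qed.

(** The step [h *: (v + c *: D)] is split into [h *: v] and a move along the single coordinate [j].
    The mean value theorem evaluates the second at a nearby point, and continuity of [pd j f] gives
    the limit. *)
Lemma is_derive_add_coord f x v j c d :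
  (forall y, derivable f y (delta_mx j ord0)) -> continuous (pd j f) ->
  is_derive x v f d ->
  is_derive x (v + c *: delta_mx j ord0) f (d + c * pd j f x).
Proof.
move=> dfj cpd /is_derive_cvgP dfv; apply/is_derive_cvgP.
set D : 'cV[R]_m := delta_mx j ord0.
suff cq : (fun h : R => h^-1 *: (f (h *: (v + c *: D) + x) - f (h *: v + x)))
    @ 0^' --> c * pd j f x.
  have -> : (fun h : R => h^-1 *: (f (h *: (v + c *: D) + x) - f x)) =
      (fun h : R => h^-1 *: (f (h *: (v + c *: D) + x) - f (h *: v + x))) +
      (fun h : R => h^-1 *: (f (h *: v + x) - f x)).
    apply/funext => h.
    transitivity (h^-1 *: (f (h *: (v + c *: D) + x) - f (h *: v + x)) +
      h^-1 *: (f (h *: v + x) - f x)) => //.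
    by rewrite -scalerDr addrA subrK.
  by rewrite [d + _]addrC; exact: (cvgD cq dfv).
apply/cvgrPdist_le => e e0.
pose e' := e / (`|c| + 1).
have c1 : 0 < `|c| + 1 by rewrite ltr_wpDl.
have e'0 : 0 < e' by rewrite divr_gt0.
have := cpd x => /cvgrPdist_le /(_ _ e'0) /nbhs_ballP [r /= r0 Hr].
(* The mean value point is at distance at most [|h| * K] from [x], hence inside the ball of radius
   [r] once [|h| < r / K]. *)
pose K := `|v| + `|c *: D| + 1.
have K0 : 0 < K by rewrite ltr_wpDl // addr_ge0.
exists (r / K) => /=; first by rewrite divr_gt0.
move=> h /=; rewrite sub0r normrN => hr hn0.
have dline y : is_derive y ((h * c) *: D) f (h * c * pd j f y).
  by apply: is_derive_scale_dir; exact: is_derive_pd.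
have [t t01 E] := MVT_dir (h *: v + x) dline.
rewrite [h *: (v + _)]scalerDr scalerA [_ + (h * c) *: D]addrC -addrA E.
rewrite -mulrA [_ *: _]mulKf // -mulrBr normrM.
set y := t *: _ + _.
suff /Hr /= le1 : ball x r y.
  apply: (@le_trans _ _ (`|c| * e')); first exact: ler_wpM2l.
  rewrite /e' mulrA ler_pdivrMr // mulrC.
  by apply: ler_wpM2l; [exact: ltW|rewrite lerDl].
rewrite -ball_normE /= /y addrA opprD addrCA subrr addr0 normrN.
apply: (@le_lt_trans _ _ (`|h| * K)); last by rewrite -ltr_pdivlMr.
apply: (le_trans (ler_normD _ _)).
have n1 : `|t *: ((h * c) *: D)| <= `|h| * `|c *: D|.
  rewrite -scalerA !normrZ -[leRHS]mul1r; apply: ler_wpM2r.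
    by rewrite !mulr_ge0.
  by move: t01; rewrite in_itv /= => /andP[/ltW t0 /ltW t1]; rewrite ger0_norm.
rewrite [`|h *: v|]normrZ /K !mulrDr mulr1; have := normr_ge0 h; lra.
Qed.

Lemma is_derive_expR_comp f x v d : is_derive x v f d ->
  is_derive x v (fun u => expR (f u)) (d * expR (f x)).
Proof.
move=> /is_derive_lineP df; apply/is_derive_lineP.
have -> : f x = f ((0 : R) *: v + x) by rewrite scale0r add0r.
by rewrite mulrC; exact: (@is_derive1_comp _ expR (fun h : R => f (h *: v + x))).
Qed.

Lemma is_derive_lincomb (V : normedModType R) n (a d : 'I_n -> R)
    (F : 'I_n -> V -> R) (x v : V) :
  (forall l, is_derive x v (F l) (d l)) ->
  is_derive x v (fun u => \sum_l a l * F l u) (\sum_l a l * d l).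
Proof.
move=> dF; have -> : (fun u => \sum_l a l * F l u) = \sum_l a l \*: F l.
  by apply/funext => u; rewrite fct_sumE.
exact: is_derive_sum (fun l => is_deriveZ (a l) (dF l)).
Qed.

(** Starting from the zero direction, the coordinates of [v] are added one at a time by
    [is_derive_add_coord]. *)
Lemma is_derive_smooth f x v : smooth f ->
  is_derive x v f (\sum_j v j ord0 * pd j f x).
Proof.
move=> sf.
have -> : v = \sum_j v j ord0 *: delta_mx j ord0.
  rewrite {1}(matrix_sum_delta v); apply: eq_bigr => i _; by rewrite big_ord1.
rewrite (eq_bigr (fun j => v j ord0 * pd j f x)); last first.
  move=> j _; congr (_ * _).
  rewrite summxE (bigD1 j) //= big1 => [|i ij]; rewrite !mxE ?eqxx.
    by rewrite mulr1 addr0.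
  by rewrite eq_sym (negbTE ij) mulr0.
elim: (index_enum _) => [|j s IH]; first by rewrite !big_nil; exact: is_derive0.
rewrite !big_cons addrC [X in is_derive _ _ _ X]addrC.
apply: is_derive_add_coord => //; first exact: smooth_derivable.
exact/smooth_continuous/smooth_pd.
Qed.

Lemma pd_comp_affine f (B : 'M[R]_m) b i x : smooth f ->
  pd i (fun u => f (B *m u + b)) x = \sum_j B j i * pd j f (B *m x + b).
Proof.
move=> sf; apply: pd_eq; apply/is_derive_lineP.
have := is_derive_smooth (B *m x + b) (B *m delta_mx i ord0) sf.
rewrite -colE.
under eq_bigr do rewrite !mxE.
move=> /is_derive_lineP; congr (is_derive _ _ _ _).
apply/funext => h; congr f.
by rewrite mulmxDr -scalemxAr colE addrA.
Qed.

End Directional.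

Section Affine.
Context {R : realType} {m : nat}.
Variables (B : 'M[R]_m) (b : 'cV[R]_m).
Let s (u : 'cV[R]_m) := B *m u + b.

Let sE k : (fun u => s u k ord0) = fun u => linform (row k B) u + b k ord0.
Proof.
by apply/funext => u; rewrite mxE /linform -row_mul [in RHS]mxE.
Qed.

Lemma smooth_affine : smooth_mx s.
Proof.
move=> i j; rewrite (ord1 j) sE; apply: smoothD; first exact: smooth_linform.
exact: smooth_cst.
Qed.

Lemma jac_affine x : jac s x = B.
Proof.
apply/matrixP => k i; rewrite mxE sE pdD; last first.
- exact/smooth_derivable/smooth_cst.
- exact/smooth_derivable/smooth_linform.
by rewrite pd_cst addr0 pd_linform mxE.
Qed.

Lemma pd_mx_jac_affine i x : pd_mx i (jac s) x = 0.
Proof.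
apply/matrixP => k j; rewrite !mxE.
under [X in pd i X x]eq_fun do rewrite jac_affine.
exact: pd_cst.
Qed.

End Affine.

Lemma pd_mx_sandwich {R : realType} {m a b : nat} (F : 'cV[R]_m -> 'M[R]_(a, b))
    (r : 'rV[R]_a) (v : 'cV[R]_b) i x : smooth_mx F ->
  (r *m pd_mx i F x *m v) ord0 ord0 =
  pd i (fun u => (r *m F u *m v) ord0 ord0) x.
Proof.
move=> sF.
have E (M : 'M[R]_(a, b)) : (r *m M *m v) ord0 ord0 =
    \sum_l \sum_k (r ord0 k * v l ord0) * M k l.
  rewrite mxE; apply: eq_bigr => l _; rewrite mxE mulr_suml.
  by apply: eq_bigr => k _; ring.
rewrite E; under [X in pd i X x]eq_fun do rewrite E.
rewrite pd_sum => [|l _]; last by apply: smooth_sum => k _; exact: smoothZ.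
apply: eq_bigr => l _.
rewrite pd_sum => [|k _]; last exact: smoothZ.
by apply: eq_bigr => k _; rewrite mxE pdZ //; exact: smooth_derivable.
Qed.

(** * Metrics with exponential coefficients *)

Section ExpMetric.
Context {R : realType} {m : nat}.
Variables (Q Qi c : 'M[R]_m).
Hypothesis QiQ : Qi *m Q = 1%:M.
Implicit Types (u x : 'cV[R]_m) (I J K L : 'I_m).

Let QQi : Q *m Qi = 1%:M. Proof. exact: mulmx1C. Qed.

(* In the frame given by the columns of Q, whose coordinates are Qi *m u, the metric
   is diagonal with coefficients exp (2 F_K), where F_K is the linear form with row
   K of c as coefficients; in the standard coordinates this is the row expo K. *)
Definition expo K : 'rV[R]_m := row K (c *m Qi).

Definition expdiag u : 'M[R]_m :=
  diag_mx (\row_K expR (2 * linform (expo K) u)).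

Definition expmetric u : 'M[R]_m := Qi^T *m expdiag u *m Qi.

(* The (K, L) entry is the Christoffel symbol Gamma^K_JL in the frame Q. *)
Definition expgamma u J : 'M[R]_m := \matrix_(K, L)
  ((K == J)%:R * c K L + (K == L)%:R * c K J
   - (J == L)%:R * c J K * expR (2 * (linform (expo J) u - linform (expo K) u))).

(** The frame [Q] is constant, so passing to standard coordinates conjugates the symbols and turns
    the direction index, with no inhomogeneous term. *)
Definition expconn : christoffel R m :=
  fun u I => \sum_J Qi J I *: (Q *m expgamma u J *m Qi).

Lemma expoE K I : expo K ord0 I = \sum_J c K J * Qi J I.
Proof. by rewrite !mxE. Qed.

Lemma expmetricE u a b : expmetric u a b =
  \sum_K Qi K a * Qi K b * expR (linform (2 *: expo K) u).
Proof.
rewrite /expmetric -mulmxA mxE; apply: eq_bigr => K _.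
rewrite mul_diag_mx !mxE linformZl; ring.
Qed.

Lemma smooth_expmetric : smooth_mx expmetric.
Proof.
move=> a b; under eq_fun do rewrite expmetricE.
by apply: smooth_sum => K _; apply: smoothZ; exact: smooth_exp_linform.
Qed.

Lemma trmx_expmetric u : (expmetric u)^T = expmetric u.
Proof. by rewrite /expmetric !trmx_mul trmxK tr_diag_mx mulmxA. Qed.

Lemma expmetric_gt0 u (v : 'cV[R]_m) : v != 0 ->
  0 < (v^T *m expmetric u *m v) ord0 ord0.
Proof.
move=> v0; set w := Qi *m v.
have w0 : w != 0.
  apply: contra_neq v0 => w0.
  by rewrite -[v]mul1mx -QQi -mulmxA -/w w0 mulmx0.
have -> : (v^T *m expmetric u *m v) ord0 ord0 =
    \sum_K expR (2 * linform (expo K) u) * w K ord0 ^+ 2.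
  rewrite /expmetric !mulmxA -trmx_mul -/w -2!mulmxA -/w mxE.
  apply: eq_bigr => K _.
  rewrite mul_diag_mx !mxE expr2; ring.
have ge0 K : 0 <= expR (2 * linform (expo K) u) * w K ord0 ^+ 2.
  by rewrite mulr_ge0 ?expR_ge0 ?sqr_ge0.
rewrite lt_neqAle sumr_ge0 // andbT eq_sym; apply: contra_neqN w0 => /eqP s0.
apply/matrixP => K j; rewrite ord1 [RHS]mxE.
have /psumr_eq0P/(_ s0)/(_ K isT)/eqP := fun K (_ : true) => ge0 K.
by rewrite mulf_eq0 gt_eqF ?expR_gt0 //= expf_eq0 /= => /eqP.
Qed.

Lemma metric_expmetric : metric expmetric.
Proof.
by split; [exact: smooth_expmetric|exact: trmx_expmetric|exact: expmetric_gt0].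
Qed.

Lemma expgammaE u J K L : expgamma u J K L =
  (K == J)%:R * c K L + (K == L)%:R * c K J
  + - ((J == L)%:R * c J K) * expR (linform (2 *: (expo J - expo K)) u).
Proof. by rewrite mxE linformZl linformDl linformNl mulNr. Qed.

Lemma expgammaC u J K L : expgamma u J K L = expgamma u L K J.
Proof.
rewrite !mxE [L == J]eq_sym [X in _ - X = _](_ : _ =
  (J == L)%:R * c L K * expR (2 * (linform (expo L) u - linform (expo K) u))).
  by ring.
by case: eqP => [->|] //; rewrite !mul0r.
Qed.

Lemma expconnE u I a b : expconn u I a b =
  \sum_J \sum_L \sum_K Qi J I * Q a K * Qi L b * expgamma u J K L.
Proof.
rewrite summxE; apply: eq_bigr => J _; rewrite mxE mxE mulr_sumr.
apply: eq_bigr => L _; rewrite mxE mulr_suml mulr_sumr.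
by apply: eq_bigr => K _; ring.
Qed.

Lemma smooth_expgamma J K L : smooth (fun u => expgamma u J K L).
Proof.
under eq_fun do rewrite expgammaE.
apply: smoothD; first exact: smooth_cst.
by apply: smoothZ; exact: smooth_exp_linform.
Qed.

Lemma smooth_expconn I : smooth_mx (expconn^~ I).
Proof.
move=> a b; under eq_fun do rewrite expconnE.
do 3!apply: smooth_sum => ? _.
by apply: smoothZ; exact: smooth_expgamma.
Qed.

Lemma torsion_free_expconn : torsion_free expconn.
Proof.
move=> x I J K; rewrite !expconnE [RHS]exchange_big; apply: eq_bigr => J' _.
apply: eq_bigr => L _; apply: eq_bigr => K' _.
rewrite expgammaC; ring.
Qed.

(** This is metric compatibility in the frame: the right-hand side is the derivative of [expdiag]
    along the [J]-th frame vector. Off the diagonal the terms cancel because the exponential in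
    [expgamma] trades one diagonal coefficient for another. *)
Lemma expgamma_compat u J :
  (expgamma u J)^T *m expdiag u + expdiag u *m expgamma u J =
  diag_mx (\row_K (2 * c K J * expR (2 * linform (expo K) u))).
Proof.
apply/matrixP => K L; rewrite mul_mx_diag mul_diag_mx !mxE.
have E A B : expR (2 * linform (expo B) u) *
    expR (2 * (linform (expo A) u - linform (expo B) u)) =
    expR (2 * linform (expo A) u).
  by rewrite -expRD; congr expR; ring.
have := E J L; have := E J K.
move: (expR (2 * (_ - linform (expo L) u))) => eJL.
move: (expR (2 * (_ - linform (expo K) u))) => eJK HK HL.
transitivity (expR (2 * linform (expo L) u) *
    ((L == J)%:R * c L K + (L == K)%:R * c L J) +
  expR (2 * linform (expo K) u) *
    ((K == J)%:R * c K L + (K == L)%:R * c K J) -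
  (J == K)%:R * c J L * (expR (2 * linform (expo L) u) * eJL) -
  (J == L)%:R * c J K * (expR (2 * linform (expo K) u) * eJK)); first by ring.
rewrite HK HL [J == K]eq_sym [J == L]eq_sym [L == K]eq_sym.
have [<-|_] := eqVneq K L.
  have [->|_] := eqVneq K J; rewrite !(mulr1n, mulr0n); ring.
have [->|_] := eqVneq K J; have [->|_] := eqVneq L J;
  rewrite !(mulr1n, mulr0n); ring.
Qed.

Lemma pd_mx_expmetric u I : pd_mx I expmetric u =
  Qi^T *m diag_mx (\row_K (2 * expo K ord0 I * expR (2 * linform (expo K) u)))
    *m Qi.
Proof.
apply/matrixP => a b; rewrite [LHS]mxE.
under [X in pd I X u]eq_fun do rewrite expmetricE.
rewrite pd_sum => [|K _]; last by apply: smoothZ; exact: smooth_exp_linform.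
rewrite -mulmxA [RHS]mxE; apply: eq_bigr => K _.
rewrite pdZ ?pd_exp_linform; last exact/smooth_derivable/smooth_exp_linform.
by rewrite mul_diag_mx !mxE linformZl; ring.
Qed.

Lemma cov_expconn u I : cov expconn expmetric u I = 0.
Proof.
rewrite /cov -addrA -opprD; apply/eqP; rewrite subr_eq0; apply/eqP.
rewrite /expconn raddf_sum /= mulmx_suml mulmx_sumr -big_split /=.
transitivity (\sum_J Qi J I *: (Qi^T *m
    ((expgamma u J)^T *m expdiag u + expdiag u *m expgamma u J) *m Qi)).
  rewrite pd_mx_expmetric.
  under [RHS]eq_bigr do rewrite expgamma_compat scalemxAl scalemxAr.
  rewrite -mulmx_suml -mulmx_sumr; congr (_ *m _ *m _).
  apply/matrixP => K L; rewrite summxE.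
  under [RHS]eq_bigr do rewrite !mxE.
  rewrite mxE mxE expoE.
  case: (K == L) => /=; last first.
    by rewrite mulr0n big1 // => J _; rewrite mulr0n mulr0.
  rewrite !mulr1n -!mulrA mulrCA mulr_suml.
  by apply: eq_bigr => J _; rewrite mulr1n; ring.
apply: eq_bigr => J _; rewrite linearZ /= -scalemxAl -scalemxAr -scalerDr.
congr (_ *: _); rewrite !trmx_mul mulmxDr mulmxDl /expmetric !mulmxA.
by rewrite -(mulmxA _ Q^T) -(trmx_mul Qi Q) -(mulmxA _ Qi Q) QiQ trmx1 !mulmx1.
Qed.

Lemma connection_on_expconn (G : set ('cV[R]_m -> 'cV[R]_m)) :
  (forall s, G s -> preserves s expconn) -> connection_on G expconn.
Proof. by split=> // I; exact: smooth_expconn. Qed.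

(** * Similarities: affine maps that are diagonal in the frame *)

Section Similarity.
Variables (l : 'rV[R]_m) (b : 'cV[R]_m) (r : R).
Hypothesis cl : c *m diag_mx l = c.
Hypothesis lr : forall K, l ord0 K ^+ 2 * expR (2 * linform (expo K) b) = r ^+ 2.
Let B := Q *m diag_mx l *m Qi.
Let s (u : 'cV[R]_m) := B *m u + b.

Let clE K L : c K L * l ord0 L = c K L.
Proof. by rewrite -{2}cl mul_mx_diag mxE. Qed.

(** By [cl] the linear part of [s] leaves every form F_K unchanged, so only the translation by [b]
    contributes. *)
Lemma linform_expo_sim K u :
  linform (expo K) (s u) = linform (expo K) u + linform (expo K) b.
Proof.
rewrite linformD; congr (_ + _).
rewrite /linform /expo mulmxA -row_mul -mulmxA.
by rewrite [Qi *m _]mulmxA [Qi *m (_ *m _)]mulmxA QiQ mul1mx mulmxA cl.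
Qed.

Lemma diag_expdiag_sim u :
  diag_mx l *m expdiag (s u) *m diag_mx l = r ^+ 2 *: expdiag u.
Proof.
apply/matrixP => K L.
rewrite mul_diag_mx mul_mx_diag !mxE.
have [<-|_] := eqVneq K L; last by rewrite !mulr0n mulr0 mul0r mulr0.
rewrite !mulr1n linform_expo_sim mulrDr expRD -(lr K) expr2; ring.
Qed.

Lemma expmetric_sim u : B^T *m expmetric (s u) *m B = r ^+ 2 *: expmetric u.
Proof.
rewrite /expmetric /B !trmx_mul tr_diag_mx !mulmxA.
rewrite -(mulmxA _ Q^T) -(trmx_mul Qi Q) QiQ trmx1 mulmx1.
rewrite -(mulmxA _ Qi Q) QiQ mulmx1.
rewrite -!mulmxA [_ *m (expdiag _ *m _)]mulmxA [_ *m (_ *m Qi)]mulmxA.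
by rewrite diag_expdiag_sim -scalemxAl -scalemxAr.
Qed.

(** The terms without exponential match by [clE]. In the remaining one, where [J = L], either
    [c L K = 0] or [K] has eigenvalue 1; in the latter case [lr] at [K] and at [L] compares the two
    exponentials. *)
Lemma expgamma_sim u J :
  diag_mx l *m expgamma u J = l ord0 J *: (expgamma (s u) J *m diag_mx l).
Proof.
apply/matrixP => K L; rewrite mul_diag_mx mul_mx_diag !mxE !linform_expo_sim.
have h1 : l ord0 K * ((K == J)%:R * c K L) =
    l ord0 J * ((K == J)%:R * c K L * l ord0 L).
  have [->|_] := eqVneq K J; last by rewrite !(mul0r, mulr0).
  by rewrite mul1r clE.
have h2 : l ord0 K * ((K == L)%:R * c K J) =
    l ord0 J * ((K == L)%:R * c K J * l ord0 L).
  have [->|_] := eqVneq K L; last by rewrite !(mul0r, mulr0).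
  by rewrite mul1r -[in LHS](clE L J); ring.
have alg (k j z a1 a2 y y' : R) : k * a1 = j * (a1 * z) ->
    k * a2 = j * (a2 * z) -> k * y = j * (y' * z) ->
    k * (a1 + a2 - y) = j * ((a1 + a2 - y') * z).
  by move=> E1 E2 E3; rewrite mulrBr mulrDr E1 E2 E3; ring.
apply: alg => // {h1 h2}.
have [->|_] := eqVneq J L; last by rewrite !(mul0r, mulr0).
have [->|cLK0] := eqVneq (c L K) 0; first by rewrite !(mulr0, mul0r, oppr0).
have lK : l ord0 K = 1 by apply: (mulfI cLK0); rewrite clE mulr1.
have lne : expR (2 * linform (expo K) b) != 0 by rewrite gt_eqF ?expR_gt0.
rewrite lK !mul1r; apply: (mulIf lne).
transitivity (c L K * expR (2 * (linform (expo L) u - linform (expo K) u)) *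
  (l ord0 L ^+ 2 * expR (2 * linform (expo L) b))).
  by rewrite lr -(lr K) lK expr1n mul1r.
have -> : expR (2 * (linform (expo L) u + linform (expo L) b -
    (linform (expo K) u + linform (expo K) b))) =
  expR (2 * (linform (expo L) u - linform (expo K) u)) *
  (expR (2 * linform (expo L) b) / expR (2 * linform (expo K) b)).
  by rewrite -expRN -!expRD; congr expR; ring.
by field.
Qed.

(** An affine map has constant Jacobian, so the second-derivative term of [preserves] vanishes. What
    remains is [expgamma_sim], with [Qi *m B = diag_mx l *m Qi] reindexing the sum over
    directions. *)
Lemma preserves_expconn : preserves s expconn.
Proof.
move=> x I; rewrite pd_mx_jac_affine add0r.
under [RHS]eq_bigr do rewrite jac_affine.
rewrite jac_affine /expconn mulmx_sumr.
transitivity (\sum_J (Qi *m B) J I *: (Q *m expgamma (s x) J *m Qi *m B)).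
  apply: eq_bigr => J _; rewrite /B !mulmxA QiQ mul1mx mul_diag_mx mxE.
  rewrite -(mulmxA _ Qi Q) QiQ mulmx1 -scalemxAr !mulmxA.
  rewrite -(mulmxA _ Qi Q) QiQ mulmx1 -(mulmxA Q (diag_mx l)) expgamma_sim.
  by rewrite -!scalemxAr -!scalemxAl scalerA mulrC !mulmxA.
under [RHS]eq_bigr do rewrite mulmx_suml scaler_sumr.
rewrite exchange_big; apply: eq_bigr => J _ /=.
under [RHS]eq_bigr do rewrite -scalemxAl scalerA mulrC.
by rewrite -scaler_suml; congr (_ *: _); rewrite mxE.
Qed.

Lemma pullback_expmetric x : pullback s expmetric x = r ^+ 2 *: expmetric x.
Proof. by rewrite /pullback jac_affine expmetric_sim. Qed.

End Similarity.

Lemma expconn_sandwich u I k (w : 'cV[R]_m) :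
  (row k Qi *m expconn u I *m (Q *m w)) ord0 ord0 =
  \sum_J Qi J I * (row k (expgamma u J) *m w) ord0 ord0.
Proof.
rewrite /expconn mulmx_sumr mulmx_suml summxE; apply: eq_bigr => J _.
rewrite -scalemxAr -scalemxAl mxE; congr (_ * _).
rewrite !mulmxA -(mulmxA _ Qi Q) QiQ mulmx1 -row_mul.
by rewrite QiQ -row_mul mul1mx.
Qed.

(* The k-th component of R(k-th frame vector, w) w at 0. The hypotheses on k make
   row k of the symbols constant, so no derivative of them is involved. *)
Lemma flat_expconn k (w : 'cV[R]_m) : flat expconn ->
  (forall J, c J k = 0) -> w k ord0 = 0 ->
  \sum_M c k M * (2 * w M ord0 * (c *m w) M ord0 -
    \sum_N w N ord0 ^+ 2 * c N M) = (c *m w) k ord0 ^+ 2.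
Proof.
move=> fl ck wk.
have rowk u J : (row k (expgamma u J) *m w) ord0 ord0 =
    (row k (expgamma 0 J) *m w) ord0 ord0.
  by rewrite !mxE; apply: eq_bigr => M _; rewrite !mxE ck !(mulr0, mul0r).
have der0 x I J : (row k Qi *m pd_mx I (expconn^~ J) x *m (Q *m w)) ord0 ord0 = 0.
  rewrite pd_mx_sandwich; last exact: smooth_expconn.
  under [X in pd I X x]eq_fun => u.
    rewrite expconn_sandwich; under eq_bigr do rewrite rowk; over.
  exact: pd_cst.
pose G J := expgamma 0 J.
pose E (J : 'I_m) : 'cV[R]_m := delta_mx J ord0.
pose phi M := (row k Qi *m M *m (Q *m w)) ord0 ord0.
have phiD M N : phi (M + N) = phi M + phi N by rewrite /phi mulmxDr mulmxDl mxE.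
have phiN M : phi (- M) = - phi M by rewrite /phi mulmxN mulNmx mxE.
have phi_sum (v : 'cV[R]_m) (F : 'I_m -> 'M[R]_m) :
    phi (\sum_I v I ord0 *: F I) = \sum_I v I ord0 * phi (F I).
  rewrite /phi mulmx_sumr mulmx_suml summxE; apply: eq_bigr => I _.
  by rewrite -scalemxAr -scalemxAl mxE.
have comm I J : phi (expconn 0 I *m expconn 0 J) = phi (expconn 0 J *m expconn 0 I).
  have := congr1 phi (fl 0 I J).
  rewrite /curvature !phiD !phiN {1 2}/phi !der0 /phi mulmx0 mul0mx [RHS]mxE.
  by rewrite subrr add0r => /eqP; rewrite subr_eq0 => /eqP.
have frame (v : 'cV[R]_m) : \sum_I (Q *m v) I ord0 *: expconn 0 I =
    Q *m (\sum_J v J ord0 *: G J) *m Qi.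
  under eq_bigr do rewrite scaler_sumr.
  rewrite exchange_big mulmx_sumr mulmx_suml; apply: eq_bigr => J _ /=.
  under eq_bigr do rewrite scalerA.
  rewrite -scaler_suml -scalemxAr -scalemxAl; congr (_ *: _).
  rewrite -[v in RHS]mul1mx -QiQ -mulmxA mxE.
  by apply: eq_bigr => I _; rewrite mulrC.
have Gk : G k = \sum_J E k J ord0 *: G J.
  rewrite (bigD1 k) //= mxE !eqxx scale1r big1 ?addr0 // => J /negbTE nJ.
  by rewrite mxE nJ scale0r.
pose Gw := \sum_J w J ord0 *: G J.
have prodG M N : phi (Q *m M *m Qi *m (Q *m N *m Qi)) =
    \sum_L M k L * (N *m w) L ord0.
  rewrite /phi !mulmxA -(mulmxA _ Qi Q) QiQ mulmx1.
  rewrite -!row_mul QiQ mul1mx -(mulmxA _ Qi Q) QiQ mulmx1.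
  by rewrite -mulmxA mxE [LHS]mxE; apply: eq_bigr => L _.
(* Contracting [comm] with the [k]-th frame vector in one slot and the combination [w] of frame
   vectors in the other equates the [k]-th components of [G k *m Gw *m w] and [Gw *m G k *m w]. *)
have : \sum_L G k k L * (Gw *m w) L ord0 = \sum_L Gw k L * (G k *m w) L ord0.
  rewrite -!prodG Gk -!frame mulmx_suml [in RHS]mulmx_sumr.
  under eq_bigr do rewrite -scalemxAl.
  under [in RHS]eq_bigr do rewrite -scalemxAr.
  rewrite !phi_sum; apply: eq_bigr => I _; congr (_ * _).
  rewrite mulmx_sumr mulmx_suml.
  under eq_bigr do rewrite -scalemxAr.
  under [in RHS]eq_bigr do rewrite -scalemxAl.
  by rewrite !phi_sum; apply: eq_bigr => J _; congr (_ * _).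
have G0 J K L : G J K L =
    (K == J)%:R * c K L + (K == L)%:R * c K J - (J == L)%:R * c J K.
  rewrite mxE; congr (_ - _).
  by rewrite /linform !mulmx0 mxE subrr mulr0 expR0 mulr1.
have sum_delta (f : 'I_m -> R) M : \sum_J (M == J)%:R * f J = f M.
  rewrite (bigD1 M) //= eqxx mul1r big1 ?addr0 // => J; rewrite eq_sym.
  by move=> /negbTE->; rewrite mul0r.
have GwE M N : Gw M N = w M ord0 * c M N + (M == N)%:R * (c *m w) M ord0 -
    w N ord0 * c N M.
  rewrite summxE -[w M ord0 * _](sum_delta (fun J => w J ord0 * c M N)).
  rewrite -[w N ord0 * _](sum_delta (fun J => w J ord0 * c J M)) mxE mulr_sumr.
  rewrite -big_split -sumrB; apply: eq_bigr => J _ /=.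
  rewrite mxE G0 [N == J]eq_sym; ring.
have -> : \sum_L G k k L * (Gw *m w) L ord0 =
    \sum_M c k M * (2 * w M ord0 * (c *m w) M ord0 -
      \sum_N w N ord0 ^+ 2 * c N M).
  apply: eq_bigr => M _; congr (_ * _).
    rewrite G0 eqxx mul1r; have [<-|_] := eqVneq k M; first by rewrite !ck; ring.
    by rewrite !mul0r subr0 addr0.
  rewrite [LHS]mxE.
  under eq_bigr do rewrite GwE mulrBl mulrDl.
  rewrite sumrB big_split /=; congr (_ - _); last first.
    by apply: eq_bigr => N _; ring.
  under [X in _ + X]eq_bigr do rewrite -mulrA.
  rewrite sum_delta [(c *m w) M ord0]mxE.
  under [X in X + _]eq_bigr do rewrite -mulrA.
  by rewrite -mulr_sumr; ring.
move=> ->.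
(* Row [k] of [Gw] retains only its diagonal entry, the [k]-th entry of [c *m w], because [w] has no
   [k]-th component and column [k] of [c] is zero. *)
under eq_bigr do rewrite GwE wk ck mul0r mulr0 add0r subr0 -mulrA.
rewrite sum_delta expr2; congr (_ * _).
rewrite !mxE; apply: eq_bigr => N _; rewrite G0 eqxx mul1r !ck.
by rewrite mulr0 addr0 subr0.
Qed.

(** The coefficient of the [k]-th coordinate is constant and no coefficient depends on that
    coordinate. It splits off as a flat factor, and its differential is parallel. *)
Lemma row_expconn k u I : (forall J, c k J = 0) -> (forall J, c J k = 0) ->
  row k Qi *m expconn u I = 0.
Proof.
move=> ck ck'; rewrite /expconn mulmx_sumr big1 // => J _.
rewrite -scalemxAr !mulmxA -!row_mul QiQ mul1mx row_mul.
rewrite [row k _](_ : _ = 0) ?mul0mx ?scaler0 //.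
by apply/rowP => L; rewrite !mxE !ck ck' !(mulr0, mul0r) addr0 subr0.
Qed.

Lemma transport_expconn k x y P (v : 'cV[R]_m) :
  (forall J, c k J = 0) -> (forall J, c J k = 0) -> transport expconn x y P ->
  row k Qi *m (P *m v) = row k Qi *m v.
Proof.
move=> ck ck'; elim=> [|y' z {}P S g _ IH _ _ _ HV]; first by rewrite mul1mx.
rewrite -{}IH -mulmxA; have [V [parV V0 V1]] := HV (P *m v).
rewrite -{}V1 -{}V0; apply/matrixP => i j; rewrite !ord1 {i j}.
have E t : (row k Qi *m V t) ord0 ord0 = \sum_l Qi k l * V t l ord0.
  by rewrite mxE; apply: eq_bigr => l _; rewrite mxE.
rewrite !E; apply/eqP; rewrite -subr_eq0 -{1}[1]addr0; apply/eqP.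
apply: (@is_derive_line_constant R _ (fun t : R => \sum_l Qi k l * V t l ord0)).
move=> t; have := is_derive_lincomb (Qi k) (parV t).
congr (is_derive _ _ _ _).
transitivity (- \sum_I derive1 (fun s => g s I ord0) t *
    (row k Qi *m expconn (g t) I *m V t) ord0 ord0); last first.
  by rewrite big1 ?oppr0 // => I _; rewrite row_expconn // mul0mx mxE mulr0.
under eq_bigr do rewrite summxE mulrN mulr_sumr.
rewrite sumrN exchange_big; congr (- _); apply: eq_bigr => I _ /=.
rewrite -mulmxA mxE mulr_sumr; apply: eq_bigr => l _.
rewrite mxE mulrCA; congr (_ * (_ * _)); by rewrite mxE.
Qed.

(* The invariant hyperplane is the kernel of the k-th coordinate form of the frame,
   which is parallel; no uniqueness of parallel transport is needed. *)
Lemma reducible_expconn (G : set ('cV[R]_m -> 'cV[R]_m)) k k' :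
  (forall J, c k J = 0) -> (forall J, c J k = 0) -> k' != k ->
  (forall s x, G s -> exists2 l : 'rV[R]_m,
    jac s x = Q *m diag_mx l *m Qi & l ord0 k != 0) ->
  forall x, reducible (holonomy G expconn x).
Proof.
move=> ck ck' nk Gl x.
pose f : 'Hom('cV[R]_m, 'M[R]_1) := linfun (mulmx (row k Qi)).
have fE v : f v = row k Qi *m v by rewrite lfunE.
have fQ K : f (col K Q) = ((k == K)%:R)%:M.
  rewrite fE; apply/matrixP => i j; rewrite !ord1 -row_mul.
  transitivity ((Qi *m Q) k K); last by rewrite QiQ !mxE eqxx.
  by rewrite !mxE; apply: eq_bigr => L _; rewrite mxE.
have colQ0 K : col K Q != 0.
  apply/eqP => Q0; have /matrixP/(_ K ord0) : Qi *m col K Q = 0.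
    by rewrite Q0 mulmx0.
  rewrite colE mulmxA QiQ mul1mx !mxE !eqxx => /eqP; apply/negP; exact: oner_neq0.
exists (lker f); split.
(* The frame vector [k'] lies in the kernel and the frame vector [k] does not, so the hyperplane is
   neither zero nor everything. *)
- apply/eqP => K0; have : col k' Q \in lker f.
    by rewrite memv_ker fQ [k == k']eq_sym (negbTE nk) raddf0.
  by rewrite K0 memv0; apply/negP; exact: colQ0.
- apply/eqP => KT; have : col k Q \in lker f by rewrite KT memvf.
  rewrite memv_ker fQ eqxx => /eqP/matrixP/(_ ord0 ord0)/eqP.
  by rewrite !mxE mulr1n; apply/negP; exact: oner_neq0.
move=> P v [s Gs tr]; rewrite !memv_ker !fE => /eqP v0.
(* The transport is [jac s x *m P]. The Jacobian multiplies the [k]-th coordinate form by the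
   nonzero factor [l ord0 k], which can be cancelled. *)
have [l jl lk] := Gl s x Gs.
have := transport_expconn v ck ck' tr; rewrite v0 jl -!mulmxA.
rewrite [row k Qi *m _]mulmxA -row_mul QiQ row1.
have -> : (delta_mx 0 k : 'rV[R]_m) *m (diag_mx l *m (Qi *m (P *m v))) =
    l ord0 k *: (row k Qi *m (P *m v)).
  by rewrite mulmxA -rowE row_diag_mx -scalemxAl -rowE row_mul.
by move=> /eqP; rewrite scaler_eq0 (negbTE lk).
Qed.

End ExpMetric.

(** * Weyl structures of such metrics *)

Section CovConformal.
Context {R : realType} {m : nat}.
Implicit Types (f k : 'cV[R]_m -> R) (h : 'cV[R]_m -> 'M[R]_m).

(** Since [h] is parallel, only the conformal factor is differentiated; the Lee form of the rescaled
    metric is therefore [- grad f]. *)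
Lemma cov_conformal (D : christoffel R m) h f x i :
  smooth_mx h -> smooth f -> cov D h x i = 0 ->
  cov D (fun u => expR (2 * f u) *: h u) x i =
  (2 * pd i f x) *: (expR (2 * f x) *: h x).
Proof.
move=> sh sf hD.
have pdE : pd_mx i (fun u => expR (2 * f u) *: h u) x =
    (2 * pd i f x * expR (2 * f x)) *: h x + expR (2 * f x) *: pd_mx i h x.
  apply/matrixP => a b; rewrite !mxE; apply: pd_eq.
  rewrite (_ : (fun y => (expR (2 * f y) *: h y) a b) =
    (fun y => expR (2 * f y)) * (fun y => h y a b)); last first.
    by apply/funext => y; rewrite mxE.
  have d1 : is_derive x (delta_mx i ord0) (fun y => expR (2 * f y))
      (2 * pd i f x * expR (2 * f x)).
    apply: is_derive_expR_comp.
    by apply: (is_deriveZ 2); exact/is_derive_pd/smooth_derivable.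
  have d2 : is_derive x (delta_mx i ord0) (fun y => h y a b)
      (pd i (fun y => h y a b) x) by exact/is_derive_pd/smooth_derivable.
  apply: is_derive_eq; rewrite addrC; congr (_ + _).
  exact: mulrC.
rewrite /cov pdE -scalemxAr -scalemxAl -!scalerN -!addrA -!scalerDr !addrA.
by rewrite -/(cov D h x i) hD scaler0 addr0 scalerA.
Qed.

End CovConformal.

Lemma metric_neq0 {R : realType} {m : nat} (g : 'cV[R]_m -> 'M[R]_m) (k : 'I_m) x :
  metric g -> g x != 0.
Proof.
move=> [_ _ gpos]; apply: contraT; rewrite negbK => /eqP g0.
have : (delta_mx k ord0 : 'cV[R]_m) != 0.
  apply/eqP => /matrixP/(_ k ord0)/eqP.
  by rewrite !mxE !eqxx; apply/negP; exact: oner_neq0.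
by move=> /(gpos x); rewrite g0 mulmx0 mul0mx mxE ltxx.
Qed.

Section ExpLCP.
Context {R : realType} {m : nat}.
Variables (Q Qi c : 'M[R]_m) (G : set ('cV[R]_m -> 'cV[R]_m)) (k0 : 'I_m).
Hypothesis QiQ : Qi *m Q = 1%:M.

(* s is then a similarity of ratio r of the metric [expmetric Qi c]. Since the
   index k0 is fixed by l, the form F_k0 increases by ln r under s, and
   exp (- 2 F_k0) times that metric is s-invariant. *)
Definition diag_similarity (s : 'cV[R]_m -> 'cV[R]_m) (l : 'rV[R]_m) b r :=
  [/\ s = (fun u => Q *m diag_mx l *m Qi *m u + b), c *m diag_mx l = c,
      0 < r, l ord0 k0 = 1
    & forall k, l ord0 k ^+ 2 * expR (2 * linform (expo Qi c k) b) = r ^+ 2].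

Hypothesis Gsim : forall s, G s -> exists l b r, diag_similarity s l b r.

Let alpha := expo Qi c k0.
Let h := expmetric Qi c.
Let D := expconn Q Qi c.
(** Subtracting row [k0] from every row divides the metric by exp(2 F_k0) and keeps it of
    exponential type, so that the similarity lemmas apply to [g] with ratio 1. *)
Let c0 : 'M[R]_m := \matrix_(k, j) (c k j - c k0 j).
Let g := expmetric Qi c0.

Let expo_c0 k : expo Qi c0 k = expo Qi c k - alpha.
Proof.
apply/rowP => j; rewrite !mxE -sumrB; apply: eq_bigr => i _.
by rewrite !mxE mulrBl.
Qed.

Let gE u : g u = expR (2 * - linform alpha u) *: h u.
Proof.
apply/matrixP => a b; rewrite expmetricE [RHS]mxE expmetricE mulr_sumr; apply: eq_bigr => k _.
rewrite expo_c0 !linformZl linformDl linformNl mulrDr expRD.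
by rewrite mulrA [RHS]mulrC.
Qed.

Let alpha_sim s l b r u : diag_similarity s l b r ->
  linform alpha (s u) = linform alpha u + linform alpha b.
Proof. by move=> [-> cl _ _ _]; rewrite linform_expo_sim. Qed.

Let metric_on_g : metric_on G g.
Proof.
split=> [|s x /Gsim[l [b [r [-> cl r0 lk0 lr]]]]]; first exact: (metric_expmetric _ QiQ).
rewrite (@pullback_expmetric _ _ Q Qi c0 QiQ l b 1) ?expr1n ?scale1r //.
  apply/matrixP => i j; rewrite mul_mx_diag !mxE.
  have cE k : c k j * l ord0 j = c k j by rewrite -[in RHS]cl mul_mx_diag mxE.
  by rewrite mulrBl !cE.
move=> k; rewrite expo_c0 linformDl linformNl mulrDr expRD mulrA lr.
have := lr k0; rewrite lk0 expr1n mul1r => <-.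
by rewrite -expRD mulrN subrr expR0.
Qed.

Definition expclass : set ('cV[R]_m -> 'M[R]_m) :=
  [set g' | metric_on G g' /\ conformal g g'].

Lemma conformal_class_exp : conformal_class G expclass.
Proof. by exists g. Qed.

(** Both [g'] and [g] are invariant and [g] does not vanish, so the conformal factor, and with it
    its exponent [f], is invariant. *)
Let expclassE g' : expclass g' -> exists2 f : 'cV[R]_m -> R, smooth f &
  (forall x, g' x = expR (2 * (f x - linform alpha x)) *: h x) /\
  (forall s x, G s -> f (s x) = f x).
Proof.
move=> [[_ inv'] [f sf g'E]]; exists f; first exact: sf.
split=> [x|s x Gs].
  by rewrite g'E gE scalerA -expRD -mulrDr.
have [mg inv] := metric_on_g.
have := inv' s x Gs; rewrite /pullback !g'E -scalemxAr -scalemxAl.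
rewrite -[X in _ *: X = _]/(pullback s g x) inv // => /eqP.
rewrite -subr_eq0 -scalerBl scaler_eq0 (negbTE (metric_neq0 k0 x mg)) orbF.
rewrite subr_eq0 => /eqP/expR_inj; apply: mulfI.
by rewrite pnatr_eq0.
Qed.

Let lee_coord (f : 'cV[R]_m -> R) x i j :
  (alpha - grad f x) i j = alpha ord0 j - pd j f x.
Proof.
by rewrite mxE [X in _ + X]mxE [X in _ - X]mxE (ord1 i).
Qed.

Let expclass_lee g' (f : 'cV[R]_m -> R) : smooth f ->
  (forall x, g' x = expR (2 * (f x - linform alpha x)) *: h x) ->
  lee_form D g' (fun x => alpha - grad f x).
Proof.
move=> sf g'E x i.
have sfa : smooth (fun u => f u - linform alpha u).
  by apply: smoothD => //; apply: smoothN; exact: smooth_linform.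
have -> : g' = fun x => expR (2 * (f x - linform alpha x)) *: h x by exact/funext.
rewrite cov_conformal //; [|exact: smooth_expmetric|exact: (cov_expconn _ QiQ)].
congr (_ *: _); rewrite pdD; last first.
- by apply: smooth_derivable; apply: smoothN; exact: smooth_linform.
- exact: smooth_derivable.
rewrite (_ : pd i (fun u => - linform alpha u) x = - (alpha ord0 i)).
  by rewrite lee_coord; move: (alpha ord0 i) (pd i f x) => a b; ring.
rewrite -(_ : (fun u => -1 * linform alpha u) = (fun u => - linform alpha u)).
  by rewrite pdZ ?pd_linform ?mulN1r //; exact/smooth_derivable/smooth_linform.
by apply/funext => u; rewrite mulN1r.
Qed.

Let alphaB s l b r : diag_similarity s l b r ->
  alpha *m (Q *m diag_mx l *m Qi) = alpha.
Proof.
move=> [_ cl _ _ _]; rewrite /alpha /expo -row_mul !mulmxA.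
by rewrite -(mulmxA _ Qi Q) QiQ mulmx1 cl.
Qed.

Lemma weyl_exp : weyl G expclass D.
Proof.
split; last 1 first.
- move=> g' /[dup] cg' /expclassE[f sf [g'E fG]].
  exists (fun x => alpha - grad f x); last exact: expclass_lee.
  split=> [i j|s x Gs].
    rewrite (_ : (fun x => _) = fun x => alpha i j + - pd j f x).
      by apply: smoothD; [exact: smooth_cst|exact/smoothN/smooth_pd].
    by apply/funext => x; rewrite lee_coord (ord1 i).
  have [l [b [r sim]]] := Gsim Gs; have aB := alphaB sim.
  case: sim => sE _ _ _ _.
  rewrite {2}sE jac_affine mulmxBl aB; congr (_ - _).
  apply/rowP => i; rewrite !mxE.
  transitivity (pd i (fun u => f (s u)) x).
    rewrite sE pd_comp_affine //; apply: eq_bigr => j _.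
    by rewrite [grad f _ _ _]mxE mulrC.
  by congr (pd i _ x); apply/funext => u; exact: fG.
- apply: connection_on_expconn => s /Gsim[l [b [r [-> cl r0 _ lr]]]].
  exact: (preserves_expconn QiQ cl lr).
exact: torsion_free_expconn.
Qed.

Let g_in : expclass g.
Proof.
split=> //; exists (fun=> 0); first exact: smooth_cst.
by move=> x; rewrite mulr0 expR0 scale1r.
Qed.

Lemma closed_weyl_exp : closed_weyl expclass D.
Proof.
pose z (_ : 'cV[R]_m) : R := 0; have sz : smooth z by exact: smooth_cst.
exists g, (fun x => alpha - grad z x); split=> //.
  by apply: expclass_lee => // x; rewrite gE /z sub0r.
move=> x i j.
have E k : (fun y => (alpha - grad z y) ord0 k) = fun=> alpha ord0 k.
  by apply/funext => y; rewrite lee_coord pd_cst subr0.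
by rewrite !E !pd_cst.
Qed.

(** If the Lee form [alpha - grad f] were the differential of an invariant [F], then [F + f] would
    be invariant with differential [alpha]. Comparing its values at [0] and [s 0] gives alpha(b) =
    0, hence ratio 1. *)
Lemma non_exact_exp s l b r : G s -> diag_similarity s l b r -> r != 1 ->
  ~ exact_weyl G expclass D.
Proof.
move=> Gs sim r1 [g' [theta [cg' lee [F [sF FG] thetaE]]]].
have [f sf [g'E fG]] := expclassE cg'.
have lee' := expclass_lee sf g'E.
have [[mg' _] _] := cg'.
have pdH x i : pd i (fun u => F u + f u) x = alpha ord0 i.
  rewrite pdD; [|exact: smooth_derivable..].
  have := lee x i; rewrite lee' => /eqP.
  rewrite -subr_eq0 -scalerBl scaler_eq0 (negbTE (metric_neq0 k0 x mg')) orbF.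
  rewrite subr_eq0 => /eqP/mulfI; rewrite oppr_eq0 pnatr_eq0 => /(_ isT).
  rewrite thetaE lee_coord [grad F x _ _]mxE; by move=> /eqP; rewrite subr_eq => /eqP ->.
have sH : smooth (fun u => F u + f u) by exact: smoothD.
have dH y : is_derive y (s 0) (fun u => F u + f u) (linform alpha (s 0)).
  have := is_derive_smooth y (s 0) sH; congr (is_derive _ _ _ _).
  by rewrite linformE; apply: eq_bigr => i _; rewrite pdH mulrC.
have := is_derive_line_constant dH 0; rewrite addr0 FG // fG // subrr.
rewrite (alpha_sim _ sim) {1}/linform mulmx0 mxE add0r => ab0.
case: sim => _ _ r0 lk0 /(_ k0); rewrite lk0 -/alpha -ab0 mulr0 expR0 expr1n mulr1.
move=> /esym/eqP; rewrite sqrf_eq1 (negbTE r1) /= => /eqP rN1.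
by move: r0; rewrite rN1 ltr0N1.
Qed.

Lemma weyl_metric_exp : weyl_metric expclass D h.
Proof.
split; [exact: (metric_expmetric _ QiQ)| |exact: (cov_expconn _ QiQ)].
move=> g' /expclassE[f sf [g'E fG]].
exists (fun x => linform alpha x - f x).
  by apply: smoothD; [exact: smooth_linform|exact: smoothN].
move=> x; rewrite g'E scalerA -expRD -mulrDr addrA subrK subrr mulr0 expR0.
by rewrite scale1r.
Qed.

Lemma similarity_ratiosP s l b r t : diag_similarity s l b r -> 0 < t ->
  (forall x, pullback s h x = t ^+ 2 *: h x) -> t = r.
Proof.
move=> [-> cl r0 _ lr] t0 /(_ 0).
rewrite (pullback_expmetric QiQ cl lr) => /eqP.
rewrite -subr_eq0 -scalerBl scaler_eq0.
rewrite (negbTE (metric_neq0 k0 0 (metric_expmetric c QiQ))) orbF subr_eq0.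
by rewrite eqrXn2 ?ltW // => /eqP.
Qed.

Lemma diag_similarity_ratio s l b r : G s -> diag_similarity s l b r ->
  similarity_ratios G h r.
Proof.
move=> Gs sim; split; first by case: sim.
exists s => // x; case: sim => [-> cl _ _ lr].
exact: (pullback_expmetric QiQ cl lr).
Qed.

End ExpLCP.

(** * Ranks of multiplicative subgroups *)

(** Padding with zero rows produces a singular square matrix, which has a nonzero integer kernel
    vector. *)
Lemma int_kernel_wide n m (M : 'M[int]_(n, m)) : (n < m)%N ->
  exists2 k : 'cV[int]_m, k != 0 & M *m k = 0.
Proof.
move=> ltnm; pose S : 'M[int]_m :=
  \matrix_(i, j) if insub (i : nat) : option 'I_n is Some i' then M i' j else 0.
have dS : \det S^T == 0.
  rewrite det_tr; apply/det0P; exists (delta_mx ord0 (Ordinal ltnm)).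
    by apply/eqP => /matrixP/(_ ord0 (Ordinal ltnm)); rewrite !mxE !eqxx.
  by rewrite -rowE; apply/rowP => j; rewrite !mxE insubF //= ltnn.
have [v v0 vS] := det0P dS; exists v^T; first by rewrite trmx_eq0.
apply/trmx_inj; rewrite trmx_mul trmxK trmx0; apply/rowP => i.
have /rowP/(_ (widen_ord (ltnW ltnm) i)) := vS.
rewrite !mxE => S0; rewrite -[RHS]S0; apply: eq_bigr => j _.
by congr (_ * _); rewrite !mxE /= valK.
Qed.

Lemma prodf_exprz (F : fieldType) (I : Type) (r : seq I) (f : I -> F) (a : int) :
  \prod_(i <- r) f i ^ a = (\prod_(i <- r) f i) ^ a.
Proof.
by rewrite (big_morph (fun x : F => x ^ a) (id1 := 1) (op1 := *%R)) ?exp1rz //;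
  move=> x y; exact: expfzMl.
Qed.

Section MulRank.
Context {R : realType} {n : nat}.
Implicit Types (v : 'I_n -> R) (z : 'cV[int]_n).

Definition powz v z : R := \prod_l v l ^ z l ord0.

Lemma powz_gt0 v z : (forall l, 0 < v l) -> 0 < powz v z.
Proof. by move=> v0; apply: prodr_gt0 => l _; exact: exprz_gt0. Qed.

Lemma powz0 v : powz v 0 = 1.
Proof. by rewrite /powz big1 // => l _; rewrite mxE expr0z. Qed.

Lemma powzD v z w : (forall l, v l != 0) -> powz v (z + w) = powz v z * powz v w.
Proof.
move=> v0; rewrite /powz -big_split; apply: eq_bigr => l _ /=.
by rewrite mxE expfzDr.
Qed.

Lemma powzN v z : powz v (- z) = (powz v z)^-1.
Proof.
rewrite /powz -prodfV; apply: eq_bigr => l _.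
by rewrite mxE invr_expz.
Qed.

Lemma powzZ v a z : powz v (a *: z) = powz v z ^ a.
Proof.
by rewrite /powz -prodf_exprz; apply: eq_bigr => l _; rewrite mxE mulrC exprz_exp.
Qed.

Lemma powz_delta v l : powz v (delta_mx l ord0) = v l.
Proof.
rewrite /powz (bigD1 l) //= mxE !eqxx expr1z big1 ?mulr1 // => i /negbTE il.
by rewrite mxE il expr0z.
Qed.

Lemma normr_powz v z : `|powz v z| = powz (fun l => `|v l|) z.
Proof.
rewrite /powz normr_prod; apply: eq_bigr => l _.
by case: (z l ord0) => i; rewrite ?NegzE -?invr_expz ?normfV normrX.
Qed.

Lemma powz_expR v z : (forall l, 0 < v l) ->
  powz v z = expR (\sum_l ln (v l) * (z l ord0)%:~R).
Proof.
move=> v0; rewrite expR_sum; apply: eq_bigr => l _.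
rewrite -[LHS]lnK ?posrE ?exprz_gt0 //; congr expR.
case: (z l ord0) => i; first by rewrite lnXn // mulr_natr.
by rewrite NegzE -invr_expz lnV ?posrE ?exprn_gt0 // lnXn // mulrNz mulrN mulr_natr.
Qed.

Lemma smallest_mul_subgroupE v : (forall l, 0 < v l) ->
  smallest mul_subgroup (range v) = range (powz v).
Proof.
move=> v0; have vn0 l : v l != 0 by rewrite gt_eqF.
apply/seteqP; split=> [x|_ [z _ <-] K [[Kpos K1 KM KV] Kv]].
  apply; split; last by move=> _ [l _ <-]; exists (delta_mx l ord0); rewrite ?powz_delta.
  split=> [_ [z _ <-]||_ _ [z _ <-] [w _ <-]|_ [z _ <-]].
  - exact: powz_gt0.
  - by exists 0; rewrite ?powz0.
  - by exists (z + w); rewrite ?powzD.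
  - by exists (- z); rewrite ?powzN.
apply: (big_ind K) => // l _.
have Kl : K (v l) by apply: Kv; exists l.
have KX (i : nat) : K (v l ^+ i).
  by elim: i => [|i IH]; rewrite ?expr0 // exprS; exact: KM.
by case: (z l ord0) => i; [exact: KX|rewrite NegzE -invr_expz; exact/KV/KX].
Qed.

Lemma prod_powz m v (Z : 'I_m -> 'cV[int]_n) (k : 'I_m -> int) :
  (forall l, v l != 0) ->
  \prod_i powz v (Z i) ^ k i =
  powz v ((\matrix_(l, i) Z i l ord0) *m \col_i k i).
Proof.
move=> v0; under eq_bigr do rewrite /powz -prodf_exprz.
rewrite exchange_big; apply: eq_bigr => l _ /=.
rewrite mxE; under eq_bigr do rewrite exprz_exp.
rewrite (big_morph (fun a : int => v l ^ a) (id1 := 1) (op1 := *%R)) ?expr0z //.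
  by apply: eq_bigr => i _; rewrite !mxE.
by move=> a b; rewrite expfzDr.
Qed.

Lemma powz_dependent m v (u : 'I_m -> R) : (n < m)%N -> (forall l, v l != 0) ->
  (forall i, range (powz v) (u i)) -> ~ mul_indep u.
Proof.
move=> ltnm v0 uv ind.
have /choice[Z HZ] i : exists z, powz v z = u i.
  by have [z _ <-] := uv i; exists z.
have [k k0 Mk] := int_kernel_wide (\matrix_(l, i) Z i l ord0) ltnm.
suff : k = 0 by move/eqP; apply/negP.
apply/colP => i; rewrite [RHS]mxE.
apply: (ind (fun i => k i ord0)).
under eq_bigr do rewrite -HZ.
rewrite prod_powz // -[RHS](powz0 v) -Mk; congr (powz v (_ *m _)).
by apply/colP => j; rewrite mxE.
Qed.

Lemma mul_rank_indep v : (forall l, 0 < v l) -> mul_indep v ->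
  mul_rank (smallest mul_subgroup (range v)) n.
Proof.
move=> v0 ind; rewrite smallest_mul_subgroupE //; split.
  by exists v; split=> // l; exists (delta_mx l ord0); rewrite ?powz_delta.
by move=> u Hu; apply: (@powz_dependent _ v) => // l; rewrite gt_eqF.
Qed.

(* If M is the matrix of exponents of an independent family of the same size,
   then det M <> 0, and a relation k between the generators yields the relation
   (adj M) k of that family. *)
Lemma indep_mul_rank v : (forall l, 0 < v l) ->
  mul_rank (smallest mul_subgroup (range v)) n -> mul_indep v.
Proof.
move=> vgt0; have v0 l : v l != 0 by rewrite gt_eqF.
rewrite smallest_mul_subgroupE // => -[[u [uv ind]] _] k k1.
have /choice[Z HZ] i : exists z, powz v z = u i.
  by have [z _ <-] := uv i; exists z.
pose M : 'M[int]_n := \matrix_(l, i) Z i l ord0.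
have uE (w : 'cV[int]_n) : \prod_i u i ^ w i ord0 = powz v (M *m w).
  under eq_bigr do rewrite -HZ.
  rewrite prod_powz //; congr (powz v (_ *m _)).
  by apply/colP => j; rewrite mxE.
have Minj (w : 'cV[int]_n) : M *m w = 0 -> w = 0.
  move=> Mw; apply/colP => i; rewrite [RHS]mxE.
  by apply: (ind (fun i => w i ord0)); rewrite uE Mw powz0.
have dM : \det M != 0.
  rewrite -det_tr; apply/det0P => -[w w0 /(congr1 trmx)].
  rewrite trmx_mul trmxK trmx0 => /Minj/eqP; rewrite trmx_eq0.
  exact/negP.
pose kk : 'cV[int]_n := \col_i k i.
have Mkk : M *m (\adj M *m kk) = \det M *: kk.
  by rewrite mulmxA mul_mx_adj mul_scalar_mx.
have a0 : \adj M *m kk = 0.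
  apply/colP => i; rewrite [RHS]mxE; apply: (ind (fun i => (\adj M *m kk) i ord0)).
  rewrite uE Mkk powzZ [powz v kk](_ : _ = 1) ?exp1rz // -k1.
  by apply: eq_bigr => l _; rewrite mxE.
move: Mkk; rewrite a0 mulmx0 => /esym/eqP; rewrite scalemx_eq0 (negbTE dM) /=.
by move=> /eqP/colP kk0 i; have := kk0 i; rewrite !mxE.
Qed.


End MulRank.

(** * The deck group of Q *)

Section Compactness.
Context {R : realType}.

Lemma trmx_continuous m n : continuous (fun M : 'M[R]_(m, n) => M^T).
Proof.
move=> M s /= /(nbhs_ballP M^T) [e e0 es].
apply/nbhs_ballP; exists e => //= N [e1 MN]; apply: es; split=> // i j.
by rewrite !mxE; exact: MN.
Qed.

Lemma compact_unit_cube m :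
  compact [set u : 'cV[R]_m | forall i, u i ord0 \in `[0, 1]%R].
Proof.
have := @rV_compact R m (fun=> `[0, 1]%classic) (fun=> @segment_compact _ 0 1).
move=> /(continuous_compact (continuous_subspaceT (@trmx_continuous 1 m))).
congr compact; apply/seteqP; split=> [_ [v Hv <-] i|u Hu].
  by rewrite mxE; exact: Hv.
by exists u^T; rewrite ?trmxK // => i; rewrite mxE; exact: Hu.
Qed.

Lemma compact_coord_bounded m (K : set 'cV[R]_m) : compact K ->
  exists2 M : R, 0 <= M & forall u, K u -> forall i, `|u i ord0| <= M.
Proof.
move=> /compact_bounded[M [_ HM]].
exists (`|M| + 1) => [|u Ku i]; first exact: addr_ge0.
apply: (@le_trans _ _ `|u|); last first.
  by apply: HM Ku; rewrite (le_lt_trans (ler_norm M)) // ltrDl.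
rewrite [leRHS]/Num.norm /= mx_normrE.
by apply/bigmax_geP; right => /=; exists (i, ord0).
Qed.

Lemma finite_int_vectors n (M : R) :
  finite_set [set z : 'cV[int]_n | forall i, `|(z i ord0)%:~R : R| <= M].
Proof.
have [M0|M0] := leP 0 M; last first.
  case: n => [|n].
    by apply: (sub_finite_set _ (finite_set1 0)) => z _ /=; apply/colP => -[].
  rewrite (_ : mkset _ = set0); first exact: finite_set0.
  apply/seteqP; split=> // z /(_ ord0); rewrite leNgt.
  by rewrite (lt_le_trans M0).
pose N := Num.bound M.
(* The entries lie between [-N] and [N]; shifted by [N] they take [2N + 1] values. *)
pose f (w : {ffun 'I_n -> 'I_(N.*2.+1)}) : 'cV[int]_n := \col_i ((w i)%:Z - N%:Z).
apply: (sub_finite_set _ (finite_image f (@finite_finset _ setT))) => z zM.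
exists [ffun i => inord `|(z i ord0 + N%:Z)%R|%N] => //; apply/colP => i.
have : `|z i ord0| <= N%:Z.
  rewrite -(ler_int R) intr_norm; apply: (le_trans (zM i)).
  by apply/ltW; exact: archi_boundP.
rewrite mxE ffunE ler_norml => /andP[lo hi].
rewrite inordK; last first.
  by rewrite -ltz_nat gez0_abs; lia.
by rewrite gez0_abs ?addrK //; lia.
Qed.

End Compactness.

Section QGroup.
Context {R : realType} {n p : nat}.
Variable phi : 'cV[int]_n -> 'M[int]_p.
Hypothesis phiD : forall z w, phi (z + w) = phi z *m phi w.
Hypothesis phi0 : phi 0 = 1%:M.
Implicit Types (z : 'cV[int]_p) (gamma : 'cV[int]_n) (u : 'cV[R]_(p + n)).

Local Notation toR := (map_mx intr).

(** A twisted translation followed by a lattice translation. The integer matrices [phi gamma]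
    preserve the lattice, so these maps are closed under composition and make up the whole group. *)
Definition Q_elt z gamma u : 'cV[R]_(p + n) :=
  col_mx (toR (phi gamma) *m usubmx u + toR z) (dsubmx u + toR gamma).

Let phiN gamma : phi (- gamma) *m phi gamma = 1%:M.
Proof. by rewrite -phiD addNr phi0. Qed.

Let phiNr gamma : phi gamma *m phi (- gamma) = 1%:M.
Proof. by rewrite -phiD addrN phi0. Qed.

Lemma Q_elt_comp z gamma z' gamma' :
  Q_elt z gamma \o Q_elt z' gamma' = Q_elt (z + phi gamma *m z') (gamma + gamma').
Proof.
apply/funext => u; rewrite /Q_elt /= col_mxKu col_mxKd phiD map_mxM mulmxDr.
by rewrite mulmxA -addrA !map_mxD map_mxM [toR z + _]addrC !addrA
  [_ + toR gamma + _]addrAC.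
Qed.

Lemma Q_elt0 : Q_elt 0 0 = idfun.
Proof.
by apply/funext => u; rewrite /Q_elt phi0 map_mx1 mul1mx !map_mx0 !addr0 vsubmxK.
Qed.

Lemma lattice_translationE z : lattice_translation z = Q_elt z 0.
Proof.
apply/funext => u; rewrite /Q_elt phi0 map_mx1 mul1mx map_mx0 /lattice_translation.
by rewrite -{1}[u]vsubmxK add_col_mx.
Qed.

Lemma twisted_translationE gamma : twisted_translation phi gamma = Q_elt 0 gamma.
Proof. by apply/funext => u; rewrite /Q_elt map_mx0 addr0. Qed.

Lemma Q_groupE : Q_group phi = [set s | exists z gamma, s = Q_elt z gamma].
Proof.
apply/seteqP; split=> [s|_ [z [gamma ->]] K [[_ KM _] Ksub]].
  apply; split; last first.
    move=> _ [[z _ <-]|[gamma _ <-]].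
      by exists z, 0; rewrite lattice_translationE.
    by exists 0, gamma; rewrite twisted_translationE.
  split=> [|_ _ [z [gamma ->]] [z' [gamma' ->]]|_ [z [gamma ->]]].
  - by exists 0, 0; rewrite Q_elt0.
  - by rewrite Q_elt_comp; do 2!eexists.
  exists (Q_elt (- (phi (- gamma) *m z)) (- gamma)); split.
  - by do 2!eexists.
  - move=> u; rewrite -[LHS]/((_ \o _) u) Q_elt_comp addNr addNr.
    by rewrite Q_elt0.
  move=> u; rewrite -[LHS]/((_ \o _) u) Q_elt_comp mulmxN mulmxA phiNr mul1mx.
  by rewrite !addrN Q_elt0.
have -> : Q_elt z gamma = lattice_translation z \o twisted_translation phi gamma.
  rewrite lattice_translationE twisted_translationE Q_elt_comp.
  by rewrite mulmx0 addr0 add0r.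
by apply: KM; apply: Ksub; [left; exists z|right; exists gamma].
Qed.

Lemma transf_subgroup_Q : transf_subgroup (Q_group phi : set ('cV[R]_(p + n) -> _)).
Proof.
rewrite Q_groupE.
split=> [|_ _ [z [gamma ->]] [z' [gamma' ->]]|_ [z [gamma ->]]].
- by exists 0, 0; rewrite Q_elt0.
- by rewrite Q_elt_comp; do 2!eexists.
exists (Q_elt (- (phi (- gamma) *m z)) (- gamma)); split.
- by do 2!eexists.
- move=> u; rewrite -[LHS]/((_ \o _) u) Q_elt_comp addNr addNr.
  by rewrite Q_elt0.
move=> u; rewrite -[LHS]/((_ \o _) u) Q_elt_comp mulmxN mulmxA phiNr mul1mx.
by rewrite !addrN Q_elt0.
Qed.

Lemma Q_elt_affine z gamma : Q_elt z gamma =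
  fun u => block_mx (toR (phi gamma)) 0 0 1%:M *m u + col_mx (toR z) (toR gamma).
Proof.
apply/funext => u; rewrite -{2}[u]vsubmxK mul_block_col !mul0mx addr0 add0r.
by rewrite mul1mx add_col_mx.
Qed.

Lemma toR_eq0 a b (M : 'M[int]_(a, b)) : toR M = 0 :> 'M[R]_(a, b) -> M = 0.
Proof.
move=> /matrixP M0; apply/matrixP => i j; have /eqP := M0 i j.
by rewrite !mxE intr_eq0 => /eqP.
Qed.

Lemma Q_elt_fixed z gamma u : Q_elt z gamma u = u -> Q_elt z gamma = idfun.
Proof.
move=> E; have /eq_col_mx[Eu Ed] : Q_elt z gamma u = col_mx (usubmx u) (dsubmx u).
  by rewrite vsubmxK.
have g0 : gamma = 0 by apply: toR_eq0; apply: (addrI (dsubmx u)); rewrite addr0.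
have z0 : z = 0.
  apply: toR_eq0; apply: (addrI (usubmx u)).
  by rewrite addr0 -[in RHS]Eu g0 phi0 map_mx1 mul1mx.
by rewrite z0 g0 Q_elt0.
Qed.

(** The last [n] coordinates of a point of [K] and of its image bound [gamma] by [M + M]. For each
    of these finitely many [gamma] the linear part is bounded on [K] by [Ng gamma], which then
    bounds [z]. *)
Lemma Q_properly_discontinuous (K : set 'cV[R]_(p + n)) : compact K ->
  finite_set [set s | Q_group phi s /\ (s @` K) `&` K !=set0].
Proof.
move=> /compact_coord_bounded[M M0 KM].
pose Ng gamma := \sum_i \sum_j `|toR (phi gamma) i j| * M.
pose Z gamma := [set z : 'cV[int]_p | forall i, `|(z i ord0)%:~R : R| <= M + Ng gamma].
pose Gam := [set gamma : 'cV[int]_n | forall i, `|(gamma i ord0)%:~R : R| <= M + M].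
have finB : finite_set
    (\bigcup_(gamma in Gam) ((fun z => Q_elt z gamma) @` Z gamma)).
  apply: bigcup_finite; first exact: finite_int_vectors.
  by move=> gamma _; apply: finite_image; exact: finite_int_vectors.
apply: sub_finite_set finB.
move=> s []; rewrite Q_groupE => -[z [gamma ->]] [_ [[u Ku <-] Ks]].
have uM := KM _ Ku; have sM := KM _ Ks.
exists gamma => [i|].
  have -> : (gamma i ord0)%:~R =
      Q_elt z gamma u (rshift p i) ord0 - u (rshift p i) ord0 :> R.
    by rewrite /Q_elt col_mxEd !mxE; ring.
  by apply: (le_trans (ler_normB _ _)); exact: lerD.
exists z => // i.
have -> : (z i ord0)%:~R = Q_elt z gamma u (lshift n i) ord0 -
    (toR (phi gamma) *m usubmx u) i ord0 :> R.
  by rewrite /Q_elt col_mxEu [in RHS]mxE [toR z _ _]mxE; ring.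
apply: (le_trans (ler_normB _ _)); apply: lerD => //.
rewrite mxE; apply: (le_trans (ler_norm_sum _ _ _)).
rewrite /Ng [leRHS](bigD1 i) //=.
have le0 (a b c : R) : a <= b -> 0 <= c -> a <= b + c by lra.
apply: le0; last first.
  by do 2!(apply: sumr_ge0 => ? _); rewrite mulr_ge0.
apply: ler_sum => j _; rewrite normrM [usubmx u _ _]mxE.
by apply: ler_wpM2l.
Qed.

Lemma Q_cocompact : exists2 K : set 'cV[R]_(p + n), compact K &
  forall x, exists s y, [/\ Q_group phi s, K y & s y = x].
Proof.
exists [set u | forall i, u i ord0 \in `[0, 1]%R]; first exact: compact_unit_cube.
move=> x; rewrite Q_groupE.
pose fl a (v : 'cV[R]_a) : 'cV[int]_a := \col_i Num.floor (v i ord0).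
have flP a (v : 'cV[R]_a) i : (v - toR (fl a v)) i ord0 \in `[0, 1]%R.
  rewrite in_itv /= !mxE subr_ge0 ge_floor /= lerBlDl.
  by have /ltW := lt_succ_floor (v i ord0); rewrite intrD addrC.
pose gamma := fl _ (dsubmx x).
(* The matrix [phi gamma] is undone before integer parts are taken; applying it again turns the
   correction [fl _ w] into the lattice vector [phi gamma *m fl _ w]. *)
pose w := toR (phi (- gamma)) *m usubmx x.
exists (Q_elt (phi gamma *m fl _ w) gamma),
  (col_mx (w - toR (fl _ w)) (dsubmx x - toR gamma)); split.
- by do 2!eexists.
- by move=> i; case: (splitP i) => j ij;
    [rewrite (_ : i = lshift n j) ?col_mxEu //|
     rewrite (_ : i = rshift p j) ?col_mxEd //]; exact/val_inj.
rewrite /Q_elt col_mxKu col_mxKd subrK mulmxBr map_mxM subrK /w mulmxA.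
by rewrite -map_mxM phiNr map_mx1 mul1mx vsubmxK.
Qed.

Lemma deck_group_Q : deck_group (Q_group phi : set ('cV[R]_(p + n) -> _)).
Proof.
split; [exact: transf_subgroup_Q| | |exact: Q_properly_discontinuous|
  exact: Q_cocompact].
  rewrite Q_groupE => _ [z [gamma ->]]; rewrite Q_elt_affine.
  exact: smooth_affine.
by rewrite Q_groupE => _ x [z [gamma ->]]; exact: Q_elt_fixed.
Qed.

End QGroup.

(** * The LCP structure on Q *)

Section Diagonalized.
Context {R : realType} {n p : nat}.
Variables (A : 'I_n -> 'M[int]_p) (P Pi : 'M[R]_p) (lambda : 'I_p -> 'I_n -> R).
Hypothesis AU : forall l, A l \in unitmx.
Hypothesis PiP : Pi *m P = 1%:M.
Hypothesis AE : forall l,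
  map_mx intr (A l) = P *m diag_mx (\row_k lambda k l) *m Pi.

Local Notation toR := (map_mx intr).

Let PPi : P *m Pi = 1%:M. Proof. exact: mulmx1C. Qed.

Definition diagonalizes (M : 'M[int]_p) (d : 'rV[R]_p) :=
  toR M = P *m diag_mx d *m Pi.

(** Identities between integer matrices diagonal in the basis [P] thus reduce to identities between
    eigenvalues; the group law of [lattice_rep] is proved in this way. *)
Lemma diagonalizes_inj M N d : diagonalizes M d -> diagonalizes N d -> M = N.
Proof.
move=> Md Nd; apply/matrixP => i j; have /matrixP/(_ i j) := etrans Md (esym Nd).
by rewrite !mxE => /intr_inj.
Qed.

Lemma diagonalizes1 : diagonalizes 1%:M (const_mx 1).
Proof. by rewrite /diagonalizes diag_const_mx map_mx1 mulmx1 PPi. Qed.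

Lemma diagonalizes1_eigen d k : diagonalizes 1%:M d -> d ord0 k = 1.
Proof.
rewrite /diagonalizes map_mx1 => /(congr1 (fun M => Pi *m M *m P)).
rewrite mulmx1 PiP !mulmxA PiP mul1mx -mulmxA PiP mulmx1 => /matrixP/(_ k k).
by rewrite !mxE eqxx !mulr1n.
Qed.

Lemma diagonalizesM M N d d' : diagonalizes M d -> diagonalizes N d' ->
  diagonalizes (M *m N) (\row_k (d ord0 k * d' ord0 k)).
Proof.
move=> Md Nd; rewrite /diagonalizes map_mxM Md Nd !mulmxA -(mulmxA _ Pi P) PiP.
by rewrite mulmx1 -(mulmxA P (diag_mx d)) mulmx_diag.
Qed.

Lemma diagonalizes_det M d : diagonalizes M d ->
  (\det M)%:~R = \prod_k d ord0 k.
Proof.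
move=> Md; rewrite -det_map_mx Md !det_mulmx mulrAC -det_mulmx PPi det1 mul1r.
exact: det_diag.
Qed.

Lemma diagonalizes_abs_det M d : M \in unitmx -> diagonalizes M d ->
  \prod_k `|d ord0 k| = 1.
Proof.
move=> MU /diagonalizes_det dE; rewrite -normr_prod -dE -intr_norm.
by move: MU; rewrite unitmxE => /orP[] /eqP->; rewrite ?normrN normr1.
Qed.

Lemma diagonalizes_neq0 M d k : M \in unitmx -> diagonalizes M d -> d ord0 k != 0.
Proof.
move=> MU Md; have /eqP := diagonalizes_abs_det MU Md.
apply: contraTneq => dk; rewrite (bigD1 k) //= dk normr0 mul0r.
by rewrite eq_sym oner_eq0.
Qed.

Lemma diagonalizesV M d : M \in unitmx -> diagonalizes M d ->
  diagonalizes (invmx M) (\row_k (d ord0 k)^-1).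
Proof.
move=> MU Md; rewrite /diagonalizes; set N := P *m diag_mx _ *m Pi.
suff MN : toR M *m N = 1%:M.
  rewrite -[LHS]mulmx1 -MN mulmxA -map_mxM mulVmx //.
  by rewrite map_mx1 mul1mx.
rewrite Md /N !mulmxA -(mulmxA _ Pi P) PiP mulmx1 -(mulmxA P (diag_mx d)) mulmx_diag.
rewrite [\row__ _](_ : _ = const_mx 1) ?diag_const_mx ?mulmx1 //.
by apply/rowP => k; rewrite !mxE divff // (diagonalizes_neq0 k MU Md).
Qed.

Definition mxpowz (M : 'M[int]_p) (z : int) : 'M[int]_p :=
  match z with Posz i => M ^+ i | Negz i => invmx M ^+ i.+1 end.

Lemma diagonalizesX M d i : diagonalizes M d ->
  diagonalizes (M ^+ i) (\row_k d ord0 k ^+ i).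
Proof.
move=> Md; elim: i => [|i IH].
  rewrite [\row__ _](_ : _ = const_mx 1) ?diagonalizes1 //.
    exact: diagonalizes1.
  by apply/rowP => k; rewrite !mxE.
rewrite exprS; have := diagonalizesM Md IH; congr diagonalizes.
by apply/rowP => k; rewrite !mxE exprS.
Qed.

Lemma diagonalizes_mxpowz M d z : M \in unitmx -> diagonalizes M d ->
  diagonalizes (mxpowz M z) (\row_k d ord0 k ^ z).
Proof.
move=> MU Md; case: z => i; first exact: diagonalizesX.
have := diagonalizesX i.+1 (diagonalizesV MU Md); congr diagonalizes.
by apply/rowP => k; rewrite !mxE NegzE -invr_expz exprVn.
Qed.

Definition lattice_rep (gamma : 'cV[int]_n) : 'M[int]_p :=
  \prod_l mxpowz (A l) (gamma l ord0).

Lemma diagonalizes_rep gamma :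
  diagonalizes (lattice_rep gamma) (\row_k powz (lambda k) gamma).
Proof.
rewrite /lattice_rep /powz; elim: (index_enum _) => [|l s IH].
  rewrite big_nil [\row__ _](_ : _ = const_mx 1); first exact: diagonalizes1.
  by apply/rowP => k; rewrite !mxE big_nil.
rewrite big_cons.
have := diagonalizesM (diagonalizes_mxpowz (gamma l ord0) (AU l) (AE l)) IH.
by congr diagonalizes; apply/rowP => k; rewrite !mxE big_cons.
Qed.

Lemma lambda_neq0 k l : lambda k l != 0.
Proof. by have := diagonalizes_neq0 k (AU l) (AE l); rewrite mxE. Qed.

Lemma lattice_repD z w : lattice_rep (z + w) = lattice_rep z *m lattice_rep w.
Proof.
apply: diagonalizes_inj (diagonalizes_rep _) _.
have := diagonalizesM (diagonalizes_rep z) (diagonalizes_rep w).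
congr diagonalizes; apply/rowP => k; rewrite !mxE powzD // => l.
exact: lambda_neq0.
Qed.

Lemma lattice_rep0 : lattice_rep 0 = 1%:M.
Proof.
apply: diagonalizes_inj (diagonalizes_rep _) _.
have := diagonalizes1; congr diagonalizes; apply/rowP => k.
by rewrite !mxE powz0.
Qed.

Lemma lattice_rep_delta l : lattice_rep (delta_mx l ord0) = A l.
Proof.
apply: diagonalizes_inj (diagonalizes_rep _) _.
rewrite /diagonalizes AE; congr (_ *m diag_mx _ *m _).
by apply/rowP => k; rewrite !mxE powz_delta.
Qed.

Lemma range_lattice_rep : range lattice_rep = smallest GL_subgroup (range A).
Proof.
apply/seteqP; split=> [_ [z _ <-] K [[KU K1 KM KV] KA]|M].
  have KX M i : K M -> K (M ^+ i).
    by move=> KMM; elim: i => [|i IH] //; rewrite exprS; exact: KM.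
  apply: (big_ind K) => // l _; have Kl : K (A l) by apply: KA; exists l.
  by case: (z l ord0) => i; apply: KX => //; exact: KV.
apply; split; last first.
  by move=> _ [l _ <-]; exists (delta_mx l ord0); rewrite ?lattice_rep_delta.
have VE z : lattice_rep z *m lattice_rep (- z) = 1%:M.
  by rewrite -lattice_repD addrN lattice_rep0.
split=> [_ [z _ <-]||_ _ [z _ <-] [w _ <-]|_ [z _ <-]].
- by have [] := mulmx1_unit (VE z).
- by exists 0; rewrite ?lattice_rep0.
- by exists (z + w); rewrite ?lattice_repD.
exists (- z) => //; have [zU _] := mulmx1_unit (VE z).
by rewrite -[RHS]mulmx1 -(VE z) mulmxA mulVmx // mul1mx.
Qed.

End Diagonalized.

(** * The exponential metric on R^p x R^n attached to the matrices *)

Section LCPonQ.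
Context {R : realType} {n p : nat}.
Variables (A : 'I_n -> 'M[int]_p) (P Pi : 'M[R]_p) (lambda : 'I_p -> 'I_n -> R).
Hypothesis AU : forall l, A l \in unitmx.
Hypothesis PiP : Pi *m P = 1%:M.
Hypothesis AE : forall l,
  map_mx intr (A l) = P *m diag_mx (\row_k lambda k l) *m Pi.
Variables (k1 : 'I_p) (l0 : 'I_n).
Hypothesis indep : mul_indep (fun l => `|lambda k1 l|).

Let phi := lattice_rep A.
Let G : set ('cV[R]_(p + n) -> 'cV[R]_(p + n)) := Q_group phi.
Let phiD : forall z w, phi (z + w) = phi z *m phi w := lattice_repD AU PiP AE.
Let phi0 : phi 0 = 1%:M := lattice_rep0 AU PiP AE.

Let mu k l : R := ln `|lambda k l|.
Let a l : R := mu k1 l.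
Let Q : 'M[R]_(p + n) := block_mx P 0 0 1%:M.
Let Qi : 'M[R]_(p + n) := block_mx Pi 0 0 1%:M.
Let C1 : 'M[R]_(p, n) := \matrix_(k, l) (a l - mu k l).
Let C2 : 'M[R]_n := \matrix_(j, l) a l.
(** Exponents of the metric: [a - mu k] on the [k]-th eigenline and [a] on every direction of R^n.
    The zero left blocks make them depend on the R^n coordinate only. *)
Let c : 'M[R]_(p + n) := block_mx 0 C1 0 C2.

Let lambda0 k l : lambda k l != 0. Proof. exact: (lambda_neq0 AU PiP AE). Qed.

Let QiQ : Qi *m Q = 1%:M.
Proof.
by rewrite mulmx_block !(mulmx0, mul0mx, mulmx1, addr0, add0r) PiP
  -scalar_mx_block.
Qed.

Let ln_powz k (gamma : 'cV[int]_n) : powz (fun l => `|lambda k l|) gamma =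
  expR (\sum_l mu k l * (gamma l ord0)%:~R).
Proof. by apply: powz_expR => l; rewrite normr_gt0. Qed.

(** On the [k]-th eigenline the square of the eigenvalue of [phi gamma] and the growth exp(2 <a -
    mu_k, gamma>) combine to exp(2 <a, gamma>), which is also the factor on R^n. *)
Let sim z gamma : diag_similarity Q Qi c (rshift p l0) (Q_elt phi z gamma)
  (row_mx (\row_k powz (lambda k) gamma) (const_mx 1))
  (col_mx (map_mx intr z) (map_mx intr gamma))
  (powz (fun l => `|lambda k1 l|) gamma).
Proof.
have repE := diagonalizes_rep AU PiP AE gamma.
split.
- rewrite Q_elt_affine; apply/funext => u; congr (_ *m _ + _).
  rewrite diag_mx_row diag_const_mx /Q /Qi !mulmx_block.
  by rewrite !(mulmx0, mul0mx, addr0, add0r, mulmx1, mul1mx) repE.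
- apply/matrixP => i j; rewrite mul_mx_diag mxE.
  have [j' ->|j' ->] := split_ordP j.
    by rewrite /c; have [i' ->|i' ->] := split_ordP i;
      rewrite ?block_mxEul ?block_mxEdl mxE mul0r.
  by rewrite row_mxEr [const_mx _ _ _]mxE mulr1.
- by apply: powz_gt0 => l; rewrite normr_gt0.
- by rewrite row_mxEr mxE.
move=> K; rewrite [linform (expo _ _ _) _](_ : _ = (c *m (Qi *m
  col_mx (map_mx intr z) (map_mx intr gamma))) K ord0); last first.
  by rewrite /linform /expo -row_mul mxE mulmxA.
rewrite mul_block_col !mul0mx add0r addr0 mul1mx mul_block_col !mul0mx !add0r.
have [k ->|j ->] := split_ordP K.
  rewrite row_mxEl col_mxEu mxE -[_ ^+ 2]real_normK ?num_real // normr_powz.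
  rewrite !ln_powz -!expRM_natl -expRD; congr expR.
  rewrite -mulrDr; congr (_ * _); rewrite mxE -big_split; apply: eq_bigr => l _ /=.
  by rewrite !mxE /a; ring.
rewrite row_mxEr col_mxEd mxE expr1n mul1r ln_powz -expRM_natl; congr (expR (_ * _)).
by rewrite mxE; apply: eq_bigr => l _; rewrite !mxE.
Qed.

Let Gsim s : G s -> exists l b r, diag_similarity Q Qi c (rshift p l0) s l b r.
Proof. by rewrite /G Q_groupE // => -[z [gamma ->]]; do 3!eexists; exact: sim. Qed.

Let GQ z gamma : G (Q_elt phi z gamma).
Proof. by rewrite /G Q_groupE //; do 2!eexists. Qed.

Let sum_mu l : \sum_k mu k l = 0.
Proof.
have := diagonalizes_abs_det PiP (AU l) (AE l).
under eq_bigr do rewrite mxE.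
move=> /(congr1 (@ln R)); rewrite ln1 => E; apply: etrans E.
apply: expR_inj; rewrite expR_sum lnK ?posrE ?prodr_gt0 // => [|k _].
  by apply: eq_bigr => k _; rewrite lnK // posrE normr_gt0.
by rewrite normr_gt0.
Qed.

Let vgt0 l : 0 < `|lambda k1 l|. Proof. by rewrite normr_gt0. Qed.

Let v_neq1 : `|lambda k1 l0| != 1.
Proof.
apply/eqP => v1; have := indep (k := fun l => (l == l0)%:R) _ l0.
rewrite eqxx (bigD1 l0) //= eqxx expr1z v1 mul1r big1 => [|l /negbTE->];
  last by rewrite expr0z.
by move=> /(_ erefl)/eqP; rewrite oner_eq0.
Qed.

Let norm_a : 0 < \sum_l a l ^+ 2.
Proof.
have a0 : 0 < a l0 ^+ 2.
  by rewrite exprn_even_gt0 //= /a /mu ln_eq0 ?normr_gt0.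
rewrite (bigD1 l0) //= ltr_wpDr // sumr_ge0 // => l _; exact: sqr_ge0.
Qed.

Let cu k M : c M (lshift n k) = 0.
Proof.
by rewrite /c; have [i ->|i ->] := split_ordP M;
  rewrite ?block_mxEul ?block_mxEdl mxE.
Qed.

Let w : 'cV[R]_(p + n) := col_mx 0 (\col_l a l).

Let wu k : w (lshift n k) ord0 = 0.
Proof. by rewrite /w col_mxEu mxE. Qed.

Let wd j : w (rshift p j) ord0 = a j.
Proof. by rewrite /w col_mxEd mxE. Qed.

Let cur k j : c (lshift n k) (rshift p j) = a j - mu k j.
Proof. by rewrite /c block_mxEur mxE. Qed.

Let cdr i j : c (rshift p i) (rshift p j) = a j.
Proof. by rewrite /c block_mxEdr mxE. Qed.

Let cw_u k : (c *m w) (lshift n k) ord0 = \sum_l (a l - mu k l) * a l.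
Proof.
rewrite mul_block_col !mul0mx !add0r col_mxEu mxE.
by apply: eq_bigr => l _; rewrite !mxE.
Qed.

Let cw_d j : (c *m w) (rshift p j) ord0 = \sum_l a l ^+ 2.
Proof.
rewrite mul_block_col !mul0mx !add0r col_mxEd mxE.
by apply: eq_bigr => l _; rewrite !mxE expr2.
Qed.

Let nonflat : ~ flat (expconn Q Qi c).
Proof.
move=> fl; have key k : \sum_l mu k l * a l = 0 \/
    \sum_l mu k l * a l = \sum_l a l ^+ 2.
  have := flat_expconn QiQ (k := lshift n k) (w := w) fl (cu k).
  rewrite wu => /(_ erefl); rewrite cw_u big_split_ord /= big1 ?add0r => [|i _]; last by rewrite cu mul0r.
  have E j : c (lshift n k) (rshift p j) * (2 * w (rshift p j) ord0 *
      (c *m w) (rshift p j) ord0 - \sum_N w N ord0 ^+ 2 * c N (rshift p j)) =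
      (\sum_l a l ^+ 2) * ((a j - mu k j) * a j).
    rewrite [\sum_N _](_ : _ = (\sum_l a l ^+ 2) * a j).
      by rewrite cw_d cur wd; ring.
    rewrite big_split_ord /= big1 ?add0r => [|i _]; last first.
      by rewrite wu expr0n mul0r.
    by rewrite mulr_suml; apply: eq_bigr => i _; rewrite wd cdr.
  under eq_bigr do rewrite E.
  (* Flatness reads [N * S = S ^+ 2], where [S] is [N] minus the pairing of [mu k] with [a]. *)
  rewrite -mulr_sumr; set S := \sum_l (_ - _) * _; set N := \sum_l _ ^+ 2.
  have SE : \sum_l mu k l * a l = N - S.
    by rewrite -sumrB; apply: eq_bigr => l _; ring.
  rewrite SE => /eqP; rewrite -subr_eq0 expr2 -mulrBl mulf_eq0.
  by case/orP=> /eqP; [left|move=> ->; right; rewrite subr0].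
have : \sum_k \sum_l mu k l * a l = 0.
  rewrite exchange_big big1 // => l _ /=.
  by rewrite -mulr_suml sum_mu mul0r.
(* The pairings are nonnegative with sum zero, so all of them vanish; at [k1] the pairing is the
   squared norm of [a], which is positive. *)
have ge0 k : 0 <= \sum_l mu k l * a l.
  by case: (key k) => ->; rewrite ?lexx // ltW.
move=> /(psumr_eq0P (fun k _ => ge0 k))/(_ k1 isT).
rewrite (eq_bigr (fun l => a l ^+ 2)) => [s0|l _]; last by rewrite expr2.
by move: norm_a; rewrite s0 ltxx.
Qed.

Let ratios : similarity_ratios G (expmetric Qi c) =
  range (powz (fun l => `|lambda k1 l|)).
Proof.
apply/seteqP; split=> [t [t0 [s]]|_ [gamma _ <-]]; last first.
  by have h := diag_similarity_ratio QiQ (GQ 0 gamma) (sim 0 gamma); exact: h.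
rewrite {1}/G Q_groupE // => -[z [gamma ->]] st.
by exists gamma => //; rewrite (similarity_ratiosP QiQ (sim z gamma) t0 st).
Qed.

Lemma LCP_on_Q : exists c D, LCP G c D /\ LCP_rank G c D n.
Proof.
exists (expclass Qi c G (rshift p l0)), (expconn Q Qi c); split.
  split.
  - exact: deck_group_Q.
  - exact: conformal_class_exp Gsim.
  - exact: weyl_exp Gsim.
  - exact: closed_weyl_exp Gsim.
  - apply: (non_exact_exp QiQ Gsim (GQ 0 (delta_mx l0 ord0)) (sim _ _)).
    by rewrite powz_delta.
  (* Since [mu k1] is [a], row [k1] of [c] vanishes and the [k1]-th eigencoordinate is the parallel
     one; a direction of R^n serves as second index. *)
  - apply: (reducible_expconn (k := lshift n k1) (k' := rshift p l0) QiQ).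
    + move=> J; have [j ->|j ->] := split_ordP J; first exact: cu.
      by rewrite cur subrr.
    + exact: cu.
    + by rewrite eq_rlshift.
    rewrite /G Q_groupE // => _ x [z [gamma ->]].
    have [-> _ _ _ _] := sim z gamma; eexists; first exact: jac_affine.
    rewrite row_mxEl mxE; apply/prodf_neq0 => l _.
    exact: expfz_neq0.
  exact: nonflat.
exists (expmetric Qi c); first exact: weyl_metric_exp Gsim.
rewrite ratios -smallest_mul_subgroupE //.
(* The ratios already form a subgroup, so generating twice changes nothing. *)
rewrite (_ : smallest _ (smallest _ _) = smallest mul_subgroup
  (range (fun l => `|lambda k1 l|))); first exact: mul_rank_indep.
rewrite smallest_mul_subgroupE //; apply/seteqP; split=> [x|x Hx K [_]]; last exact.
apply; split=> //; split=> [_ [z _ <-]||_ _ [z _ <-] [z' _ <-]|_ [z _ <-]].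
- exact: powz_gt0.
- by exists 0; rewrite ?powz0.
- by exists (z + z'); rewrite ?powzD // => l; rewrite gt_eqF.
- by exists (- z); rewrite ?powzN.
Qed.

End LCPonQ.

Lemma basis_unitmx {R : realType} {p : nat} (e : 'I_p -> 'cV[R]_p) :
  basis_of fullv [tuple e k | k < p] ->
  (\matrix_(i, k) e k i ord0 : 'M[R]_p) \in unitmx.
Proof.
move=> /basis_free/freeP fr; rewrite unitmxE unitfE -det_tr.
apply/det0P => -[v v0 vE]; move/eqP: v0; apply; apply/rowP => k.
rewrite [RHS]mxE; apply: (fr (fun k => v ord0 k)).
apply/colP => i; have /rowP/(_ i) := vE; rewrite [RHS]mxE => E0.
rewrite [RHS]mxE -[RHS]E0 summxE mxE; apply: eq_bigr => j _.
by rewrite !mxE -tnth_nth tnth_mktuple.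
Qed.

Lemma eigenbasis_diagonalizes {R : realType} {p : nat} (e : 'I_p -> 'cV[R]_p)
    (M : 'M[int]_p) (d : 'I_p -> R) :
  (\matrix_(i, k) e k i ord0 : 'M[R]_p) \in unitmx ->
  (forall k, map_mx intr M *m e k = d k *: e k) ->
  diagonalizes (\matrix_(i, k) e k i ord0) (invmx (\matrix_(i, k) e k i ord0))
    M (\row_k d k).
Proof.
set P := \matrix_(i, k) _ => PU eig.
suff MP : map_mx intr M *m P = P *m diag_mx (\row_k d k).
  by rewrite /diagonalizes -MP -mulmxA mulmxV // mulmx1.
apply/matrixP => i k; rewrite mul_mx_diag !mxE.
have /colP/(_ i) := eig k; rewrite !mxE mulrC => <-.
by apply: eq_bigr => j _; rewrite !mxE.
Qed.

Lemma LCP_on_Q_eigenbasis {R : realType} (n p : nat) (hn : (0 < n)%N)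
    (A : 'I_n -> 'M[int]_p) (e : 'I_p -> 'cV[R]_p) (lambda : 'I_p -> 'I_n -> R)
    (k1 : 'I_p) :
  (forall l, A l \in unitmx) ->
  (\matrix_(i, k) e k i ord0 : 'M[R]_p) \in unitmx ->
  (forall k l, map_mx intr (A l) *m e k = lambda k l *: e k) ->
  mul_indep (fun l => `|lambda k1 l|) ->
  exists phi : 'cV[int]_n -> 'M[int]_p,
    [/\ is_isomorphism phi (smallest GL_subgroup (range A)),
        (forall l, phi (delta_mx l ord0) = A l)
      & exists (c : set ('cV[R]_(p + n) -> 'M[R]_(p + n)))
               (D : christoffel R (p + n)),
          LCP (Q_group phi) c D /\ LCP_rank (Q_group phi) c D n].
Proof.
move=> AU; set P := \matrix_(i, k) _ => PU heig indep.
have PiP : invmx P *m P = 1%:M by exact: mulVmx.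
have AE l : map_mx intr (A l) = P *m diag_mx (\row_k lambda k l) *m invmx P.
  exact: (eigenbasis_diagonalizes PU (heig^~ l)).
exists (lattice_rep A); split.
- split; [exact: (lattice_repD AU PiP AE)| |exact: (range_lattice_rep AU PiP AE)].
  (* If [z] and [w] have the same image, the eigenvalue at [k1] for [z - w] is 1, and independence
     of the absolute values forces [z = w]. *)
  move=> z w zw; apply/eqP; rewrite -subr_eq0; apply/eqP/colP => l.
  rewrite [RHS]mxE; apply: (indep (fun l => (z - w) l ord0)).
  have := diagonalizes_rep AU PiP AE (z - w).
  rewrite (_ : lattice_rep A (z - w) = 1%:M); last first.
    rewrite (lattice_repD AU PiP AE) zw -(lattice_repD AU PiP AE) subrr.
    exact: (lattice_rep0 AU PiP AE).
  move=> /(diagonalizes1_eigen PiP k1); rewrite mxE => E1.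
  by rewrite -[LHS]/(powz _ (z - w)) -normr_powz E1 normr1.
- exact: (lattice_rep_delta AU PiP AE).
exact: (LCP_on_Q AU PiP AE (Ordinal hn) indep).
Qed.

(** * Multiplicatively independent units from a Schur polynomial *)

Section SchurPolynomial.
Context {R : realType} {n : nat}.
Implicit Types (i j k : 'I_n.+1).

(** With spacing 4, a point within distance 1 of a node is at distance at least 3 from the others;
    this serves both to locate the roots and to make logarithms positive. *)
Definition schur_node i : int := (4 * i)%:Z.

Definition schur_poly : {poly int} := \prod_i ('X - (schur_node i)%:P) - 1.

Let node i : R := (schur_node i)%:~R.

Lemma map_schur_poly (F : nzRingType) : map_poly intr schur_poly =
  \prod_i ('X - ((schur_node i)%:~R)%:P) - 1 :> {poly F}.
Proof.
rewrite rmorphB rmorph1 rmorph_prod; congr (_ - _); apply: eq_bigr => i _.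
by rewrite rmorphB /= map_polyX map_polyC.
Qed.

Lemma horner_map_schur_poly (x : R) :
  (map_poly intr schur_poly).[x] = \prod_i (x - node i) - 1.
Proof.
rewrite map_schur_poly !hornerE horner_prod; congr (_ - _).
by apply: eq_bigr => i _; rewrite !hornerE.
Qed.

Lemma node_dist i j : i != j -> 4 <= `|node i - node j|.
Proof.
move=> ij; rewrite /node /schur_node -intrB -intr_norm -[4]/(4%:~R) ler_int.
have : (i != j :> nat) by []. lia.
Qed.

Lemma schur_prod_near (e : R) i : `|e| = 1 ->
  1 <= `|\prod_(j | j != i) (node i + e - node j)|.
Proof.
move=> e1; rewrite normr_prod; elim/big_ind: _ => // [x y x1 y1|j ij].
  by rewrite mulr_ege1.
have d : 4 <= `|node i - node j| by apply: node_dist; rewrite eq_sym.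
apply: (@le_trans _ _ (`|node i - node j| - `|e|)).
  by rewrite e1; lra.
by rewrite -[X in _ - X]normrN (le_trans (lerB_dist _ _)) // opprK addrAC.
Qed.

(** The value at the node is -1. At distance 1 it is the product of the other factors, of absolute
    value at least 1, times 1 or -1, minus 1. The two products have the same sign, so on one side
    the value is nonnegative and the intermediate value theorem applies there. *)
Lemma schur_root i : exists2 x : R, root (map_poly intr schur_poly) x &
  `|x - node i| <= 1.
Proof.
have pE (e : R) : (map_poly intr schur_poly).[node i + e] =
    e * \prod_(j | j != i) (node i + e - node j) - 1.
  by rewrite horner_map_schur_poly (bigD1 i) //= [node i + e]addrC addrK.
have p0 : (map_poly intr schur_poly).[node i] = -1.
  by rewrite -[node i]addr0 pE mul0r sub0r.
have np := @schur_prod_near 1 i (normr1 _).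
have nm := @schur_prod_near (-1) i (normrN1 _).
have same : 0 <= (\prod_(j | j != i) (node i + 1 - node j)) *
    \prod_(j | j != i) (node i + -1 - node j).
  rewrite -big_split; apply: prodr_ge0 => j ji /=.
  set d := node i - node j.
  have d4 : 4 <= `|d| by apply: node_dist; rewrite eq_sym.
  have -> : (node i + 1 - node j) * (node i + -1 - node j) = `|d| ^+ 2 - 1.
    by rewrite real_normK ?num_real // /d; ring.
  by rewrite subr_ge0 exprn_ege1 // (le_trans _ d4) // ler1n.
have [qp|qm] := leP 0 (\prod_(j | j != i) (node i + 1 - node j)).
  have le1 : node i <= node i + 1 by rewrite lerDl.
  have [|x /andP[x1 x2] rx] := poly_ivt (p := map_poly intr schur_poly) le1.
    rewrite p0 pE mul1r lerN10 /= subr_ge0.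
    by move: np; rewrite ger0_norm.
  by exists x => //; rewrite ger0_norm ?subr_ge0 // lerBlDl.
have le1 : node i - 1 <= node i by rewrite gerBl.
have [|x /andP[x1 x2] rx] := poly_ivt (p := - map_poly intr schur_poly) le1.
  rewrite !hornerN p0 pE opprK ler01 andbT oppr_le0 mulN1r subr_ge0.
  by move: nm; rewrite ler0_norm // -(nmulr_rge0 _ qm).
exists x; first by rewrite rootN in rx.
by rewrite ler0_norm ?subr_le0 // opprB; lra.
Qed.

End SchurPolynomial.

(** * Irreducibility over the rationals *)

Section SchurIrreducible.
Context {R : realType} {n : nat}.
Implicit Types (i j k : 'I_n.+1).

Local Notation f := (schur_poly (n := n)).
Local Notation ZtoR := (map_poly (intr : int -> R)).
Local Notation ZtoQ := (map_poly (intr : int -> rat)).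

Let size_prod : size (\prod_(i < n.+1) ('X - (schur_node i)%:P)) = n.+2.
Proof. by rewrite size_prod_XsubC /index_enum -enumT size_enum_ord. Qed.

Let size_oppr1 : (size (- (1 : {poly int})) < n.+2)%N.
Proof. by rewrite size_polyN size_poly1. Qed.

Lemma size_schur_poly : size f = n.+2.
Proof. by rewrite /schur_poly size_polyDl size_prod. Qed.

Lemma lead_coef_schur_poly : lead_coef f = 1.
Proof.
by rewrite /schur_poly lead_coefDl ?lead_coef_prod_XsubC ?size_prod.
Qed.

Lemma horner_schur_node i : f.[schur_node i] = -1.
Proof.
rewrite /schur_poly !hornerE horner_prod (bigD1 i) //= !hornerE subrr mul0r.
by rewrite sub0r.
Qed.

Let opp_unit1 (a b : int) : -1 = a * b -> b = - a.
Proof.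
move=> ab; have : (- b) * a = 1 by rewrite mulNr mulrC -ab opprK.
by case/intUnitRing.unitzPl/orP => /eqP a1; move: ab; rewrite a1; lia.
Qed.

(* Schur: if f = p q then p q = -1, hence p + q = 0, at the n + 1 nodes, so that
   p + q = 0 when both factors have degree at most n, and f = - p ^ 2. *)
Lemma schur_poly_factor (p q : {poly int}) :
  f = p * q -> size p = n.+2 \/ size q = n.+2.
Proof.
move=> fE; have f0 : f != 0 by rewrite -size_poly_eq0 size_schur_poly.
have [p0 q0] : p != 0 /\ q != 0.
  by apply/andP; rewrite -negb_or -mulf_eq0 -fE.
have := size_mul p0 q0; rewrite -fE size_schur_poly => sE.
have sp : (0 < size p)%N by rewrite size_poly_gt0.
have sq : (0 < size q)%N by rewrite size_poly_gt0.
have [->|np] := eqVneq (size p) n.+2; first by left.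
have [->|nq] := eqVneq (size q) n.+2; first by right.
have pq0 : p + q = 0.
  apply/eqP; apply: contraT => pqn0.
  (* Were [p + q] nonzero, its [n + 1] distinct roots would force size at least [n + 2], whereas
     both factors have size at most [n + 1]. *)
  have := max_poly_roots pqn0 (rs := [seq schur_node i | i : 'I_n.+1]).
  rewrite size_map -cardE card_ord.
  have -> : uniq [seq schur_node i | i : 'I_n.+1].
    rewrite map_inj_uniq ?enum_uniq // => i j.
    by rewrite /schur_node => -[ij]; apply: val_inj => /=; lia.
  have -> : all (root (p + q)) [seq schur_node i | i : 'I_n.+1].
    apply/allP => _ /mapP[i _ ->]; rewrite rootE hornerD.
    have := horner_schur_node i; rewrite fE hornerM; set a := p.[_]; set b := q.[_].
    by move=> /esym/opp_unit1 ->; rewrite subrr.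
  move=> /(_ isT isT); have := size_polyD p q.
  move: sp sq np nq sE; move: (size p) (size q) (size (p + q)%R); clear; lia.
have qE : q = - p by apply/eqP; rewrite -addr_eq0 addrC pq0.
have := lead_coef_schur_poly; rewrite fE qE mulrN lead_coefN lead_coefM.
have := sqr_ge0 (lead_coef p); rewrite expr2; move: (_ * _); clear; lia.
Qed.

(** By Gauss's lemma a rational divisor is a scalar multiple of an integer one, to which
    [schur_poly_factor] applies. *)
Lemma schur_poly_dvd (d : {poly rat}) : d %| ZtoQ f -> size d = 1%N \/ size d = n.+2.
Proof.
move=> /dvdpP_rat_int[p [a a0 ->] [q fE]]; rewrite size_scale // size_rat_int_poly.
have f0 : f != 0 by rewrite -size_poly_eq0 size_schur_poly.
have [p0 q0] : p != 0 /\ q != 0.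
  by apply/andP; rewrite -negb_or -mulf_eq0 -fE.
have := size_mul p0 q0; rewrite -fE size_schur_poly => sE.
have : (0 < size p)%N by rewrite size_poly_gt0.
case: (schur_poly_factor fE) => [->|sq]; [by right|left].
by move: sE; rewrite sq; move: (size p); clear; lia.
Qed.

(** The gcd of [f] and [w] over the rationals has the real root [x], so it is not constant; by
    irreducibility it is [f] up to a scalar, and [w] vanishes at every root of [f]. *)
Lemma schur_conjugate (w : {poly int}) (x y : R) :
  root (ZtoR f) x -> root (ZtoR f) y -> root (ZtoR w) x -> root (ZtoR w) y.
Proof.
have RE (p : {poly int}) : ZtoR p = map_poly ratr (ZtoQ p).
  by rewrite -map_poly_comp; apply: eq_map_poly => z /=; rewrite ratr_int.
move=> fx fy wx; pose d := gcdp (ZtoQ f) (ZtoQ w).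
have dx : root (map_poly ratr d) x by rewrite gcdp_map root_gcd -!RE fx wx.
have df : d %| ZtoQ f := dvdp_gcdl _ _.
have [s1|sd] := schur_poly_dvd df.
  move: dx; rewrite (size1_polyC (eq_leq s1)) map_polyC rootC /= fmorph_eq0 => d0.
  by have := s1; rewrite (size1_polyC (eq_leq s1)) (eqP d0) size_poly0.
have fw : ZtoQ f %| ZtoQ w.
  apply: dvdp_trans (dvdp_gcdr (ZtoQ f) _).
  rewrite -(eqp_dvdl _ (_ : d %= ZtoQ f)) // -dvdp_size_eqp // sd.
  by rewrite size_rat_int_poly size_schur_poly.
by apply: root_dvdp fy; rewrite !RE dvdp_map.
Qed.

End SchurIrreducible.

(** In the row where [|x k|] is maximal, the diagonal term would outweigh all the others unless
    [x k = 0]. *)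
Lemma diag_dominant {R : realType} n (L : 'I_n -> 'I_n -> R) (x : 'I_n -> R) :
  (forall k, \sum_(l | l != k) `|L k l| < `|L k k|) ->
  (forall k, \sum_l L k l * x l = 0) -> forall l, x l = 0.
Proof.
move=> dom Lx l.
have [k _ kmax] := @Order.TotalTheory.arg_maxP _ R 'I_n l xpredT (fun i => `|x i|) isT.
suff xk : `|x k| = 0.
  by apply/eqP; rewrite -normr_le0 -xk; exact: kmax.
apply/eqP; apply: contraT => xk0.
have xk_gt0 : 0 < `|x k| by rewrite lt_neqAle eq_sym xk0 normr_ge0.
have := dom k; rewrite -(ltr_pM2r xk_gt0) ltNge mulr_suml -normrM.
have := Lx k; rewrite (bigD1 k) //= => /eqP; rewrite addr_eq0 => /eqP ->.
rewrite normrN (le_trans (ler_norm_sum _ _ _)) //.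
apply: ler_sum => i _; rewrite normrM; apply: ler_wpM2l => //; exact: kmax.
Qed.

(** * Multiplicative independence of the distances from a root to the nodes *)

Section SchurUnits.
Context {R : realType} {n : nat}.
Variable theta : 'I_n.+1 -> R.
Hypothesis theta_root : forall k, root (map_poly intr (schur_poly (n := n))) (theta k).
Implicit Types (i j k : 'I_n.+1) (l : 'I_n).

Let node i : R := (schur_node i)%:~R.

Hypothesis theta_near : forall k, `|theta k - node k| <= 1.

Let prod1 k : \prod_i (theta k - node i) = 1.
Proof.
have := theta_root k; rewrite rootE horner_map_schur_poly subr_eq0.
by move/eqP.
Qed.

Let neq0 k i : theta k - node i != 0.
Proof.
apply/eqP => z; have := prod1 k; rewrite (bigD1 i) //= z mul0r => /eqP.
by rewrite eq_sym oner_eq0.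
Qed.

Let far k j : j != k -> 3 <= `|theta k - node j|.
Proof.
move=> jk; have := node_dist (R := R) jk; rewrite -/(node j) -/(node k) => d.
have := theta_near k; have := ler_distD (theta k) (node j) (node k).
rewrite [`|node j - theta k|]distrC; lra.
Qed.

Lemma theta_inj : injective theta.
Proof.
move=> i j ij; apply/eqP; apply: contraT => nij.
have := far nij; have := theta_near i; rewrite ij; lra.
Qed.

Let L k i : R := ln `|theta k - node i|.

Let L_far k j : j != k -> 0 < L k j.
Proof. by move=> /far d; apply: ln_gt0; lra. Qed.

Let sumL k : \sum_i L k i = 0.
Proof.
apply: expR_inj; rewrite expR_sum expR0.
transitivity `|\prod_i (theta k - node i)|; last by rewrite prod1 normr1.
rewrite normr_prod.
by apply: eq_bigr => i _; rewrite lnK // posrE normr_gt0.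
Qed.

(** Logarithms give a linear system whose matrix is [L] without row and column 0. Each full row sums
    to zero and its off-diagonal entries are positive; the removed entry makes the dominance of the
    diagonal strict. *)
Lemma schur_units_indep_all (z : 'I_n -> int) :
  (forall k, \prod_l `|theta k - node (lift ord0 l)| ^ z l = 1) ->
  forall l, z l = 0.
Proof.
move=> z1 l; apply/eqP; rewrite -(intr_eq0 R); apply/eqP.
move: l; apply: (@diag_dominant R n
  (fun a b => L (lift ord0 a) (lift ord0 b)) (fun l => (z l)%:~R)) => k.
  have := sumL (lift ord0 k); rewrite big_ord_recl (bigD1 k) //=.
  have p0 : 0 < L (lift ord0 k) ord0 by apply: L_far; rewrite neq_lift.
  have -> : \sum_(l | l != k) `|L (lift ord0 k) (lift ord0 l)| =
      \sum_(l | l != k) L (lift ord0 k) (lift ord0 l).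
    apply: eq_bigr => l lk; rewrite gtr0_norm //.
    by apply: L_far; rewrite (inj_eq lift_inj).
  have : 0 <= \sum_(l | l != k) L (lift ord0 k) (lift ord0 l).
    by apply: sumr_ge0 => l lk; apply/ltW/L_far; rewrite (inj_eq lift_inj).
  move: (\sum_(l | _) _) => S S0 E; rewrite ltr0_norm; lra.
apply: expR_inj; rewrite expR0; apply: etrans (z1 (lift ord0 k)).
rewrite [RHS](_ : _ = powz (fun l => `|theta (lift ord0 k) - node (lift ord0 l)|)
  (\col_l z l)); last by apply: eq_bigr => l _; rewrite mxE.
rewrite powz_expR => [|l]; last by rewrite normr_gt0.
by congr expR; apply: eq_bigr => l _; rewrite mxE.
Qed.

Let posz (a : int) : nat := if a is Posz i then i else 0.
Let negz (a : int) : nat := if a is Negz i then i.+1 else 0.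

(* Squaring makes the relation polynomial in x. *)
Let prodz_eq1 (x : 'I_n -> R) (z : 'I_n -> int) : (forall l, x l != 0) ->
  (\prod_l `|x l| ^ z l = 1) <->
  (\prod_l x l ^+ (2 * posz (z l)) = \prod_l x l ^+ (2 * negz (z l))).
Proof.
move=> x0; have sq (e : 'I_n -> nat) : \prod_l x l ^+ (2 * e l) =
    (\prod_l `|x l| ^+ e l) ^+ 2.
  rewrite -prodrXl; apply: eq_bigr => l _.
  by rewrite exprM [RHS]exprAC real_normK ?num_real.
pose a := \prod_l `|x l| ^+ posz (z l); pose b := \prod_l `|x l| ^+ negz (z l).
have a0 : 0 < a by apply: prodr_gt0 => l _; rewrite exprn_gt0 // normr_gt0.
have b0 : 0 < b by apply: prodr_gt0 => l _; rewrite exprn_gt0 // normr_gt0.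
have -> : \prod_l `|x l| ^ z l = a / b.
  rewrite /a /b -prodf_div; apply: eq_bigr => l _.
  by case: (z l) => i /=; rewrite ?expr0 ?invr1 ?mulr1 ?mul1r ?NegzE -?invr_expz.
rewrite !sq -/a -/b; split=> [E|/eqP].
  by congr (_ ^+ 2); rewrite -[a](divfK (lt0r_neq0 b0)) E mul1r.
by rewrite eqrXn2 ?ltW // => /eqP->; rewrite divff // lt0r_neq0.
Qed.

(** The relation at [theta ord0] says that an integer polynomial vanishes there; by
    [schur_conjugate] it vanishes at every [theta k], which supplies the whole linear system. *)
Lemma schur_units_indep : mul_indep (fun l => `|theta ord0 - node (lift ord0 l)|).
Proof.
move=> z z1; apply: schur_units_indep_all => k.
pose w : {poly int} :=
  \prod_l ('X - (schur_node (lift ord0 l))%:P) ^+ (2 * posz (z l)) -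
  \prod_l ('X - (schur_node (lift ord0 l))%:P) ^+ (2 * negz (z l)).
have wE (x : R) : (map_poly intr w).[x] =
    \prod_l (x - node (lift ord0 l)) ^+ (2 * posz (z l)) -
    \prod_l (x - node (lift ord0 l)) ^+ (2 * negz (z l)).
  rewrite /w rmorphB !rmorph_prod !hornerE !horner_prod.
  by congr (_ - _); apply: eq_bigr => l _;
    rewrite rmorphXn rmorphB /= map_polyX map_polyC !hornerE.
apply/prodz_eq1 => //; apply/eqP; rewrite -subr_eq0 -wE -rootE.
apply: (schur_conjugate (theta_root ord0) (theta_root k)).
by rewrite rootE wE subr_eq0; apply/eqP/prodz_eq1.
Qed.

End SchurUnits.

(** * The companion matrix and its integer units *)

Section SchurExample.
Context {R : realType} {n : nat}.
Variable theta : 'I_n.+1 -> R.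
Hypothesis theta_root : forall k, root (map_poly intr (schur_poly (n := n))) (theta k).
Hypothesis theta_inj : injective theta.
Implicit Types (i j k : 'I_n.+1).

(** The form of the companion matrix whose eigenvectors are the vectors of powers of the roots:
    every row but the last shifts the powers. *)
Definition schur_companion : 'M[int]_n.+1 := \matrix_(i, j)
  if i == ord_max then - (schur_poly (n := n))`_j else (j == i.+1 :> nat)%:R.

Definition schur_unit i : 'M[int]_n.+1 := schur_companion - (schur_node i)%:M.

Let e k : 'cV[R]_n.+1 := \col_i theta k ^+ i.

Lemma powers_unitmx : (\matrix_(i, k) e k i ord0 : 'M[R]_n.+1) \in unitmx.
Proof.
rewrite unitmxE unitfE (_ : \matrix_(i, k) _ = Vandermonde n.+1 (\row_k theta k)).
  rewrite det_Vandermonde; apply/prodf_neq0 => i _; apply/prodf_neq0 => j ij.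
  by rewrite !mxE subr_eq0 (inj_eq theta_inj) eq_sym neq_ltn ij.
by apply/matrixP => i k; rewrite !mxE.
Qed.

Lemma schur_companion_eigen k :
  map_mx intr schur_companion *m e k = theta k *: e k.
Proof.
apply/colP => i; rewrite [LHS]mxE [RHS]mxE [in RHS]mxE -exprS.
have [->|ni] := eqVneq i ord_max.
  have := theta_root k; rewrite rootE horner_coef size_map_inj_poly //;
    last exact: intr_inj.
  rewrite size_schur_poly big_ord_recr /= coef_map.
  have := lead_coef_schur_poly (n := n); rewrite /lead_coef size_schur_poly /= => ->.
  rewrite mul1r addr_eq0 => /eqP E.
  transitivity (- - theta k ^+ n.+1); last by rewrite opprK.
  rewrite -E -sumrN; apply: eq_bigr => j _.
  by rewrite !mxE eqxx coef_map /= mulrNz mulNr.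
have ltin : (i.+1 < n.+1)%N.
  by rewrite ltnS ltn_neqAle -ltnS ltn_ord andbT.
rewrite (bigD1 (Ordinal ltin)) //= !mxE (negbTE ni) eqxx mul1r big1 ?addr0 //.
move=> j nj; rewrite !mxE (negbTE ni).
by rewrite (_ : (j == i.+1 :> nat) = false) ?mul0r //; apply/negbTE.
Qed.

Lemma schur_unit_eigen i k :
  map_mx intr (schur_unit i) *m e k = (theta k - (schur_node i)%:~R) *: e k.
Proof.
rewrite /schur_unit map_mxB map_scalar_mx mulmxBl schur_companion_eigen.
by rewrite mul_scalar_mx scalerBl.
Qed.

(** Each root satisfies prod_j (theta_k - node_j) = 1. Multiplying over the roots shows that the
    integer determinants have product 1. *)
Lemma schur_unit_unitmx i : schur_unit i \in unitmx.
Proof.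
have PU := powers_unitmx.
have detE j : (\det (schur_unit j))%:~R =
    \prod_k (theta k - (schur_node j)%:~R) :> R.
  have := eigenbasis_diagonalizes PU (schur_unit_eigen j).
  move=> /(diagonalizes_det (mulVmx PU)) ->.
  by apply: eq_bigr => k _; rewrite mxE.
have : \prod_j \det (schur_unit j) = 1.
  apply: (@intr_inj R); rewrite rmorph_prod /=.
  under eq_bigr do rewrite detE.
  rewrite exchange_big big1 // => k _ /=.
  by have := theta_root k; rewrite rootE horner_map_schur_poly subr_eq0 => /eqP.
rewrite (bigD1 i) //= mulrC => /intUnitRing.unitzPl.
by rewrite unitmxE.
Qed.

End SchurExample.

Theorem proposition4p9 (R : realType) :
  (forall (n p : nat) (hn : (1 <= n)%N) (hp : (n.+1 <= p)%N)
     (A : 'I_n -> 'M[int]_p)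
     (hGL : forall l, A l \in unitmx)
     (hdiag : forall l, diagonalizable (map_mx intr (A l) : 'M[R]_p))
     (hcomm : forall l l', A l *m A l' = A l' *m A l)
     (e : 'I_p -> 'cV[R]_p) (lambda : 'I_p -> 'I_n -> R)
     (hbasis : basis_of fullv [tuple e k | k < p])
     (heig : forall k l, map_mx intr (A l) *m e k = lambda k l *: e k)
     (hrank : mul_rank
        (smallest mul_subgroup
           (range (fun l => `|lambda (Ordinal (leq_ltn_trans (leq0n n) hp)) l|)))
        n),
   exists phi : 'cV[int]_n -> 'M[int]_p,
     [/\ is_isomorphism phi (smallest GL_subgroup (range A)),
         (forall l, phi (delta_mx l ord0) = A l)
       & exists (c : set ('cV[R]_(p + n) -> 'M[R]_(p + n)))
                (D : christoffel R (p + n)),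
           LCP (Q_group phi) c D /\ LCP_rank (Q_group phi) c D n])
  /\
  (forall r : nat, (1 <= r)%N ->
   exists (m : nat) (G : set ('cV[R]_m -> 'cV[R]_m))
          (c : set ('cV[R]_m -> 'M[R]_m)) (D : christoffel R m),
     LCP G c D /\ LCP_rank G c D r).
Proof.
split=> [n p hn hp A hGL _ _ e lambda hbasis heig hrank|n hn].
  have PU := basis_unitmx hbasis.
  apply: (LCP_on_Q_eigenbasis hn hGL PU heig).
  apply: indep_mul_rank hrank => l; rewrite normr_gt0.
  set k := Ordinal _.
  have AE l' := eigenbasis_diagonalizes PU (heig^~ l').
  exact: (lambda_neq0 hGL (mulVmx PU) AE).
have /choice[theta thetaP] (k : 'I_n.+1) : exists x : R,
    root (map_poly intr (schur_poly (n := n))) x /\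
    `|x - (schur_node k)%:~R| <= 1.
  by have [x rx xk] := schur_root (R := R) k; exists x.
have theta_root k := proj1 (thetaP k).
have theta_near k := proj2 (thetaP k).
have inj := theta_inj theta_near.
(* Here [p] is [n + 1], the chosen eigenline is that of [theta ord0], and there is one matrix for
   each node except node 0: over all the nodes the absolute values multiply to 1, so the full family
   would be dependent. *)
have [phi [_ _ [c [D LD]]]] := LCP_on_Q_eigenbasis hn
  (A := fun l => schur_unit (lift ord0 l))
  (fun l => schur_unit_unitmx theta_root inj (lift ord0 l))
  (powers_unitmx inj)
  (fun k l => schur_unit_eigen theta_root (lift ord0 l) k)
  (schur_units_indep theta_root theta_near).
by exists (n.+1 + n)%N, (Q_group phi), c, D.
Qed.
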